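(* For each $H\in(0,1)$ there exist constants $\bar A_H,\bar B_H,\bar C_H\in(0,+\infty)$, depending only on $H$, such that for all $0\le s<t$, all $c$ with $0<c\le(t-s)^H/2$ and all $v\ge1$, $$\mathbf P\left(\sup_{\rho\in\mathbb R}K_{s,t}(c,W^H-\rho)\ge\bar C_H\,(t-s)\,c^{-1/H}\,v\right)\le\bar A_H\exp\left(-\bar B_H\,v^{1+\min(2H,1)}\right).$$
   Context: $W^H=(W^H_t)_{t\ge0}$ is a fractional Brownian motion with Hurst index $H\in(0,1)$, i.e. a centered Gaussian process with (a.s.) continuous trajectories and $\mathbf E(W^H_sW^H_t)=\frac12\{|s|^{2H}+|t|^{2H}-|t-s|^{2H}\}$ for $s,t\ge0$. For continuous $f:[0,+\infty)\to\mathbb R$, $0\le s<t$ and $c>0$, the numbers of upcrossings and downcrossings of the strip $\{(x,y):y\in[0,c]\}$ are $$U_{s,t}(c,f)=\#\{(u,v):s\le u<v\le t,\ f(u)=0,\ f(v)=c,\ f(r)\in(0,c)\ \forall r\in(u,v)\},$$ $$D_{s,t}(c,f)=\#\{(u,v):s\le u<v\le t,\ f(u)=c,\ f(v)=0,\ f(r)\in(0,c)\ \forall r\in(u,v)\},$$ $N_{s,t}(c,f)=U_{s,t}(c,f)+D_{s,t}(c,f)$, and the total number of $c$-level crossings is $$K_{s,t}(c,f)=\sum_{p\in\mathbb Z}N_{s,t}(c,f-p\cdot c).$$ For $a\in\mathbb R$, $f-a$ denotes the function $u\mapsto f(u)-a$. The quantity $c^{1/H}K_{s,t}(c,f-\rho)$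 is the $1/H$-variation of $f$ along the Lebesgue partition of $[s,t]$ for the grid $c\mathbb Z+\rho$. *)

(* Defs.v *)
From HB Require Import structures.
From mathcomp Require Import all_boot all_order all_algebra.
From mathcomp Require Import all_classical all_reals all_analysis.
Set Implicit Arguments.
Unset Strict Implicit.
Unset Printing Implicit Defensive.
Import Order.TTheory GRing.Theory Num.Theory.
Import numFieldNormedType.Exports.

Local Open Scope classical_set_scope.
Local Open Scope ring_scope.

Section LevelCrossings.
Context {R : realType}.
Implicit Types (s t c : R) (f : R -> R).

(* Functions on [0, +oo[ are represented by functions on R; for 0 <= s < t,
   the counts below only read the values on [s, t].
   Cardinals take values in \bar R, an infinite set having cardinal +oo. *)

Definition upcrossings s t c f : \bar R :=
  counting [set uv : R * R |
    [/\ s <= uv.1, uv.1 < uv.2, uv.2 <= t, f uv.1 = 0 & f uv.2 = c] /\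
    forall r, uv.1 < r < uv.2 -> 0 < f r < c].

Definition downcrossings s t c f : \bar R :=
  counting [set uv : R * R |
    [/\ s <= uv.1, uv.1 < uv.2, uv.2 <= t, f uv.1 = c & f uv.2 = 0] /\
    forall r, uv.1 < r < uv.2 -> 0 < f r < c].

Definition strip_crossings s t c f : \bar R :=
  (upcrossings s t c f + downcrossings s t c f)%E.

Definition level_crossings s t c f : \bar R :=
  \esum_(p in [set: int]) strip_crossings s t c (fun u => f u - p%:~R * c).

Definition sup_level_crossings s t c f : \bar R :=
  ereal_sup [set level_crossings s t c (fun u => f u - rho) | rho in [set: R]].

End LevelCrossings.

Section FractionalBrownianMotion.
Context {d : measure_display} {T : measurableType d} {R : realType}.
Variable P : probability T R.

(* normal_prob m 0 is not the Dirac mass at m, hence the separate case sigma = 0. *)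
Definition gaussian_variable (X : T -> R) : Prop :=
  measurable_fun [set: T] X /\
  exists m sigma : R, 0 <= sigma /\
    forall A : set R, measurable A ->
      P (X @^-1` A) = if sigma == 0 then dirac m A else normal_prob m sigma A.

Definition gaussian_process (W : R -> T -> R) : Prop :=
  forall (n : nat) (a t : 'I_n -> R), (forall i, 0 <= t i) ->
    gaussian_variable (fun w => \sum_(i < n) a i * W (t i) w).

(* Time is [0, +oo[: the variables W t with t < 0 are unconstrained. *)
Definition fractional_brownian_motion (H : R) (W : R -> T -> R) : Prop :=
  [/\ gaussian_process W,
      forall t : R, 0 <= t -> ('E_P[W t] = 0)%E,
      {ae P, forall w, {within `[0, +oo[, continuous (fun t => W t w)}} &
      forall s t : R, 0 <= s -> 0 <= t ->
        'E_P[fun w => (W s w * W t w)%R]%E =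
        (2^-1 * (`|s| `^ (2 * H) + `|t| `^ (2 * H) - `|t - s| `^ (2 * H)))%:E].

(* E belongs to the P-completion of the sigma-algebra and its probability for
   the completion of P is at most b. With trajectories that are continuous only
   almost surely and P not assumed complete, an event on trajectories is
   measurable only in this sense; if E is measurable, this says P E <= b. *)
Definition probability_le (E : set T) (b : \bar R) : Prop :=
  exists A : set T,
    [/\ measurable A, P.-negligible (A `+` E) & (P A <= b)%E].

End FractionalBrownianMotion.

(* Main.v *)
Require Import Defs.
From HB Require Import structures.
From mathcomp Require Import all_boot all_order all_algebra finmap.
From mathcomp Require Import all_classical all_reals all_analysis.
From mathcomp Require Import unstable measurable_realfun.
From mathcomp Require Import ring lra zify.
Set Implicit Arguments.
Unset Strict Implicit.
Unset Printing Implicit Defensive.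
Import Order.TTheory GRing.Theory Num.Theory.
Import numFieldNormedType.Exports.

Local Open Scope classical_set_scope.
Local Open Scope ring_scope.

(* Write h = min (2H) 1, so that the exponent of v is 1 + h, and let a packing
   be a family of disjoint time intervals on each of which the path moves by c
   between two points of a common grid: the crossings counted for a given grid
   form a packing, and conversely.

   One block of length L = c^(1/H), with a packing of size n in it: the sum of
   the n signed increments is n c. Approximate the endpoints on the grids of mesh
   L / (n 2^i), i = 0, 1, ... The correction from level i - 1 to level i is a
   linear combination of increments over cells of mesh L / (n 2^i); since the
   intervals are disjoint, the sum of the squared coefficients is at most 4 n.
   The covariances of increments over distinct cells all have the same sign, so
   a Schur test with telescoping row sums bounds the variance of the correction
   by a multiple of c^2 n^(1 - h) 2^(- h i). Requiring geometrically decreasing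
   bounds on the corrections with sum at most n c / 2, the Gaussian tail at
   level i is exp (- const n^(1 + h) 2^(h i / 2)), which beats the number
   (8 (n 2^i)^2)^n of possible roundings of the endpoints as soon as n is large.

   Many blocks: a packing of size of order (number of blocks) * v leaves on
   average at least order v intervals in a block, and Markov's inequality for
   the number of pairs (block, n) with n >= v whose bad event occurs transfers
   the one-block bound, with no loss in the number of blocks. *)

(** * Gaussian tails *)

Section GaussianTail.
Context {R : realType}.

(** The normal density at two standard deviations from the mean, times the standard deviation: a
    lower bound for the mass of an interval of length one standard deviation that stays within this
    distance. *)
Definition normal_mass : R := expR (- 2) / Num.sqrt (pi *+ 2).

Lemma normal_mass_gt0 : 0 < normal_mass.
Proof. by rewrite divr_gt0 ?expR_gt0// sqrtr_gt0 mulrn_wgt0// pi_gt0. Qed.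

Lemma normal_peakE (s : R) : 0 < s -> normal_peak s = s^-1 / Num.sqrt (pi *+ 2).
Proof.
move=> s0; rewrite /normal_peak -mulrnAr sqrtrM ?sqr_ge0// sqrtr_sqr gtr0_norm//.
by rewrite invfM.
Qed.

Lemma normal_mass_le1 : normal_mass <= 1.
Proof.
have pi0 := @pi_gt0 R.
rewrite /normal_mass ler_pdivrMr ?mul1r; last by rewrite sqrtr_gt0 mulrn_wgt0.
apply: (@le_trans _ _ 1); first by rewrite -expR0 ler_expR oppr_le0.
rewrite -{1}sqrtr1; apply: ler_wsqrtr.
by have := @pi_ge2 R; lra.
Qed.

Lemma normal_prob_itv_ge (m s a : R) : 0 < s ->
  (forall y, a <= y <= a + s -> (y - m) ^+ 2 <= 4 * s ^+ 2) ->
  (normal_mass%:E <= normal_prob m s `[a, (a + s)%R])%E.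
Proof.
move=> s0 H; rewrite /normal_prob.
have -> : (normal_mass%:E = \int[lebesgue_measure]_(x in [set` `[a, (a + s)%R]])
     (normal_peak s * expR (- 2))%:E)%E.
  rewrite integral_cst//= lebesgue_measure_itv/= lte_fin ltrDl s0.
  rewrite -EFinB -EFinM normal_peakE// /normal_mass; congr (_%:E).
  rewrite addrAC subrr add0r; field.
  have pi0 := @pi_gt0 R.
  by rewrite !lt0r_neq0// sqrtr_gt0 mulrn_wgt0.
apply: ge0_le_integral => //=.
- by move=> x _; rewrite lee_fin mulr_ge0 ?expR_ge0 ?normal_peak_ge0.
- by apply/measurable_EFinP; apply: measurable_funTS; exact: measurable_normal_pdf.
- move=> x; rewrite in_itv/= => /H hx; rewrite lee_fin normal_pdfE ?gt_eqF//.
  rewrite ler_wpM2l ?normal_peak_ge0// /normal_fun ler_expR mulNr lerN2.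
  by rewrite ler_pdivrMr ?pmulrn_lgt0 ?exprn_gt0//; lra.
Qed.

(* Comparison with the density of variance 2 s^2. *)
Lemma normal_prob_tail (m s x : R) : 0 < s -> m <= x ->
  (normal_prob m s `[x, +oo[ <= (2 * expR (- ((x - m) ^+ 2 / (4 * s ^+ 2))))%:E)%E.
Proof.
move=> s0 mx; rewrite /normal_prob.
pose r := Num.sqrt 2 * s.
have r0 : 0 < r by rewrite mulr_gt0 ?sqrtr_gt0.
have r2 : r ^+ 2 = 2 * s ^+ 2 by rewrite exprMn sqr_sqrtr.
have pk : normal_peak s = Num.sqrt 2 * normal_peak r.
  rewrite !normal_peakE// invfM mulrA mulrA mulfV ?mul1r//.
set k := expR _.
have s2 : Num.sqrt 2 <= 2 :> R.
  rewrite -[leRHS]ger0_norm// -sqrtr_sqr; apply: ler_wsqrtr; rewrite expr2; lra.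
apply: (@le_trans _ _ (\int[lebesgue_measure]_(y in `[x, +oo[%classic)
   ((2 * k)%:E * (normal_pdf m r y)%:E))%E).
  apply: ge0_le_integral => //=.
  - by move=> y _; rewrite lee_fin normal_pdf_ge0.
  - by apply/measurable_EFinP; apply: measurable_funTS; exact: measurable_normal_pdf.
  - apply: emeasurable_funM => //; apply/measurable_EFinP; apply: measurable_funTS.
    exact: measurable_normal_pdf.
  - move=> y; rewrite in_itv/= andbT => xy; rewrite -EFinM lee_fin.
    rewrite !normal_pdfE ?gt_eqF// pk -!mulrA ler_pM ?mulr_ge0 ?normal_peak_ge0//.
      by rewrite /normal_fun expR_ge0.
    rewrite mulrCA ler_wpM2l ?normal_peak_ge0//.
    rewrite /k /normal_fun -expRD ler_expR r2 -subr_ge0.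
    have -> : - ((x - m) ^+ 2 / (4 * s ^+ 2)) + - (y - m) ^+ 2 / (2 * s ^+ 2 *+ 2) -
      - (y - m) ^+ 2 / (s ^+ 2 *+ 2) = ((y - m) ^+ 2 - (x - m) ^+ 2) / (4 * s ^+ 2).
      by field; rewrite gt_eqF.
    have xym : (x - m) ^+ 2 <= ((y : R) - m) ^+ 2.
      by rewrite lerXn2r ?nnegrE ?subr_ge0 ?lerD2r// (le_trans mx).
    by apply: divr_ge0; [rewrite subr_ge0|rewrite mulr_ge0// sqr_ge0].
rewrite ge0_integralZl//=.
- rewrite -[leRHS]mule1 lee_wpmul2l ?lee_fin ?mulr_ge0 ?expR_ge0//.
  rewrite -(integral_normal_pdf m r); apply: ge0_subset_integral => //=.
    by apply/measurable_EFinP; exact: measurable_normal_pdf.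
  by move=> y _; rewrite lee_fin normal_pdf_ge0.
- apply/measurable_EFinP; apply: measurable_funTS; exact: measurable_normal_pdf.
- by move=> y _; rewrite lee_fin normal_pdf_ge0.
- by rewrite lee_fin mulr_ge0 ?expR_ge0.
Qed.

End GaussianTail.

Section GaussianVariable.
Context {d : measure_display} {T : measurableType d} {R : realType}.
Variable P : probability T R.

Lemma measure_sqr_ge (X : T -> R) (A : set R) (k : R) :
  measurable_fun [set: T] X -> measurable A -> 
  (forall y, A y -> k ^+ 2 <= y ^+ 2) ->
  ((k ^+ 2)%:E * P (X @^-1` A) <= \int[P]_w ((X w) ^+ 2)%:E)%E.
Proof.
move=> mX mA Ak.
have mXA : measurable (X @^-1` A) by rewrite -[X in measurable X]setTI; exact: mX.
rewrite -integral_cst//.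
apply: (@le_trans _ _ (\int[P]_(w in X @^-1` A) ((X w) ^+ 2)%:E)%E).
  apply: ge0_le_integral => //=.
  - by move=> w _; rewrite lee_fin sqr_ge0.
  - apply/measurable_EFinP; apply: measurable_funTS; exact: measurable_funX.
  - by move=> w /Ak; rewrite lee_fin.
apply: ge0_subset_integral => //=.
- by apply/measurable_EFinP; exact: measurable_funX.
- by move=> w _; rewrite lee_fin sqr_ge0.
Qed.

(* The mass of an interval of length sigma at distance sigma from the mean bounds
   mean and sigma by the second moment, so no moment of the normal law is computed. *)
Lemma gaussian_variable_tail (X : T -> R) (V x : R) :
  gaussian_variable P X -> 0 < V -> 0 <= x ->
  (\int[P]_w ((X w) ^+ 2)%:E <= V%:E)%E ->
  (P (X @^-1` `[x, +oo[) <=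
    (3 * expR (- (normal_mass / 16 * x ^+ 2 / V)))%:E)%E.
Proof.
move=> [mX [m [s [s0 HX]]]] V0 x0 XV.
have q0 := @normal_mass_gt0 R; have q1 := @normal_mass_le1 R.
set q := normal_mass in q0 q1 *.
have ms : q * (`|m| + s) ^+ 2 <= V.
  rewrite -lee_fin (le_trans _ XV)//.
  have [s00|sn0] := eqVneq s 0.
    have /(_ [set m]) := @measure_sqr_ge X _ m mX.
    rewrite HX// s00 eqxx diracE mem_set// mule1 => /(_ (measurable_set1 m)).
    move=> h; apply: le_trans (h _); last by move=> y ->.
    rewrite lee_fin addr0 -normrX ger0_norm ?sqr_ge0//.
    by rewrite ler_piMl ?sqr_ge0.
  have sgt0 : 0 < s by rewrite lt0r sn0.
  (* The interval lies on the side of [m] away from 0, at distance between [s] and [2 * s] from [m],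
     so that [|y| >= |m| + s] on it. *)
  pose a := if 0 <= m then m + s else m - 2 * s.
  have := @measure_sqr_ge X `[a, a + s]%classic (`|m| + s) mX.
  rewrite HX// (negbTE sn0) => h; apply: le_trans (h _ _) => //.
    rewrite muleC EFinM lee_wpmul2r// ?lee_fin ?sqr_ge0//.
    apply: normal_prob_itv_ge => // y; rewrite /a; case: ifP => m0 /andP[ya ya'].
      by rewrite -[leLHS]sqrrN; nra.
    by nra.
  move=> y; rewrite /a/= in_itv/= /a; case: ifP => m0 /andP[ya ya'].
    by rewrite ger0_norm// lerXn2r// ?nnegrE; lra.
  rewrite ltr0_norm; last by rewrite ltNge m0.
  by move/negbT: m0; rewrite -ltNge => m0; nra.
have V'0 : 0 <= V^-1 by rewrite invr_ge0 ltW.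
(* For [x <= 2 * |m|] the exponent is at least -1/4 and the bound exceeds 1. Otherwise
   [x - m >= x / 2] and the normal tail applies. *)
have [xm|mx] := leP x (2 * `|m|).
  apply: le_trans (probability_le1 _ _) _ => //.
    by rewrite -[X in measurable X]setTI; exact: mX.
  have : 1 + - (q / 16 * x ^+ 2 / V) <= expR (- (q / 16 * x ^+ 2 / V)).
    exact: expR_ge1Dx.
  have : q / 16 * x ^+ 2 / V <= 1 / 4.
    rewrite ler_pdivrMr//.
    have : q * x ^+ 2 <= q * (4 * (`|m| + s) ^+ 2).
      apply: ler_wpM2l; first exact: ltW.
      have -> : 4 * (`|m| + s) ^+ 2 = (2 * (`|m| + s)) ^+ 2 by ring.
      by have m0 := normr_ge0 m; rewrite lerXn2r// ?nnegrE; lra.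
    by lra.
  by rewrite lee_fin; lra.
rewrite HX//; have [s00|sn0] := eqVneq s 0.
  rewrite diracE memNset ?lee_fin ?mulr_ge0 ?expR_ge0//=.
  by rewrite in_itv/= andbT => xm; have := ler_norm m; have := normr_ge0 m; lra.
have sgt0 : 0 < s by rewrite lt0r sn0.
have mlex : m <= x by have := ler_norm m; have := normr_ge0 m; lra.
apply: le_trans (normal_prob_tail sgt0 mlex) _.
rewrite lee_fin ler_pM ?expR_ge0//; first lra.
rewrite ler_expR lerN2 ler_pdivlMr ?mulr_gt0 ?exprn_gt0//.
rewrite mulrAC ler_pdivrMr//.
have h1 : x ^+ 2 / 4 <= (x - m) ^+ 2.
  by have := ler_norm m; have := normr_ge0 m; nra.
have h2 : q * s ^+ 2 <= V.
  apply: le_trans ms; rewrite ler_wpM2l ?(ltW q0)//.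
  by have := normr_ge0 m; nra.
have h3 : (x ^+ 2 / 4) * (q * s ^+ 2) <= (x - m) ^+ 2 * V.
  by rewrite ler_pM// ?mulr_ge0 ?sqr_ge0// ltW.
by lra.
Qed.

End GaussianVariable.

(** * Second differences of powers and Schur's test *)

Section PowerSecondDifference.
Context {R : realType}.

Lemma powR_homo_le (r a b : R) : 0 <= r -> 0 <= a -> a <= b -> a `^ r <= b `^ r.
Proof.
by move=> r0 a0 ab; apply: ge0_ler_powR => //; rewrite nnegrE// (le_trans a0).
Qed.

Lemma midpoint_powR_le (p x y : R) : 1 <= p -> 0 <= x -> 0 <= y ->
  ((x + y) / 2) `^ p <= (x `^ p + y `^ p) / 2.
Proof.
move=> p1 x0 y0.
have h : (0 <= (2^-1 : R)) && ((2^-1 : R) <= 1).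
  by rewrite invr_ge0 ler0n invf_le1 ?ler1n.

have := @convex_powR R p p1 (Itv01 (proj1 (andP h)) (proj2 (andP h))) x y.
rewrite !inE/= !in_itv/= !andbT => /(_ x0 y0).
rewrite !convRE/= /unstable.onem => h'.
have e (a b : R) : (a + b) / 2 = 2^-1 * a + (1 - 2^-1) * b by field.
by rewrite !e.
Qed.

Variable q : R.
Hypothesis q0 : 0 < q.

(** For [q = 2 * H], twice the covariance of two unit increments of the process at lag [x]. *)
Definition second_difference (x : R) : R :=
  `|x + 1| `^ q + `|x - 1| `^ q - 2 * `|x| `^ q.

Lemma second_differenceN x : second_difference (- x) = second_difference x.
Proof.
rewrite /second_difference normrN.
have -> : - x + 1 = - (x - 1) by ring.
have -> : - x - 1 = - (x + 1) by ring.
by rewrite !normrN; ring.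
Qed.

Lemma second_difference_ge0 x : 1 <= q -> 1 <= `|x| -> 0 <= second_difference x.
Proof.
move=> q1; wlog x0 : x / 0 <= x.
  move=> h; have [x0|x0] := leP 0 x; first exact: h.
  by rewrite -second_differenceN -normrN => /h; apply; rewrite oppr_ge0 ltW.
rewrite ger0_norm// => x1; rewrite /second_difference !ger0_norm; try lra.
have := @midpoint_powR_le q (x + 1) (x - 1) q1.
have -> : (x + 1 + (x - 1)) / 2 = x by field.
by lra.
Qed.

(** Concavity of the power [q] is read off the convexity of the power [q^-1], applied to the [q]-th
    powers of [x + 1] and [x - 1]. *)
Lemma second_difference_le0 x : q <= 1 -> 1 <= `|x| -> second_difference x <= 0.
Proof.
move=> q1; wlog x0 : x / 0 <= x.
  move=> h; have [x0|x0] := leP 0 x; first exact: h.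
  by rewrite -second_differenceN -normrN => /h; apply; rewrite oppr_ge0 ltW.
rewrite ger0_norm// => x1; rewrite /second_difference !ger0_norm; try lra.
have p1 : 1 <= q^-1 by rewrite invf_ge1.
have := midpoint_powR_le p1 (powR_ge0 (x + 1) q) (powR_ge0 (x - 1) q).
have qq : q * q^-1 = 1 by rewrite mulfV ?gt_eqF.
rewrite -!powRrM qq !powRr1; try lra.
have -> : (x + 1 + (x - 1)) / 2 = x by field.
set s := _ / 2 => sx; suff : s <= x `^ q by rewrite /s; lra.
have s0 : 0 <= s by rewrite divr_ge0 ?addr_ge0 ?powR_ge0.
have -> : s = (s `^ q^-1) `^ q by rewrite -powRrM mulrC qq powRr1.
by apply: powR_homo_le; rewrite ?powR_ge0 ?(ltW q0).
Qed.

(** As [0 <= q - 1 <= 1], the power [q - 1] of [a / (a + 1)] is at least [a / (a + 1)]. Hence the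
    [q]-th power of [a] is at least [a ^ 2 / (a + 1) >= a - 1] times the power [q - 1] of
    [a + 1]. *)
Lemma powR_increment_le (a : R) : 1 <= q -> q <= 2 -> 0 <= a ->
  (a + 1) `^ q - a `^ q <= 2 * (a + 1) `^ (q - 1).
Proof.
move=> q1 q2 a0; have a1 : 0 < a + 1 by lra.
have b0 := powR_ge0 (a + 1) (q - 1).
rewrite -(@mulr_powRB1 _ (a + 1)) ?(ltW a1)//.
have [->|an0] := eqVneq a 0; first by rewrite powR0 ?gt_eqF// add0r powR1; lra.
have agt : 0 < a by rewrite lt0r an0.
rewrite -(@mulr_powRB1 _ a)//.
have h : (a + 1) `^ (q - 1) * (a / (a + 1)) <= a `^ (q - 1).
  have r0 : 0 < a / (a + 1) by rewrite divr_gt0.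
  have -> : a `^ (q - 1) = (a + 1) `^ (q - 1) * (a / (a + 1)) `^ (q - 1).
    by rewrite -powRM ?(ltW a1) ?(ltW r0)//; congr (_ `^ _); field; rewrite gt_eqF.
  rewrite ler_wpM2l//.
  apply: ger1_powR; last by lra.
  by rewrite r0/= ler_pdivrMr//; lra.
have h2 : a * ((a + 1) `^ (q - 1) * (a / (a + 1))) <= a * a `^ (q - 1).
  by rewrite ler_wpM2l.
have h3 : (a - 1) * (a + 1) `^ (q - 1) <= a * ((a + 1) `^ (q - 1) * (a / (a + 1))).
  have -> : a * ((a + 1) `^ (q - 1) * (a / (a + 1))) = (a * a / (a + 1)) * (a + 1) `^ (q - 1) by ring.
  by rewrite ler_wpM2r// ler_pdivlMr//; nra.
by lra.
Qed.

(** A second difference is a difference of first differences, so a row sum telescopes to its two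
    ends. *)
Lemma second_difference_sum (M k : nat) : (k < M)%N ->
  \sum_(l < M) second_difference (l%:R - k%:R) =
    ((M - k.+1)%N%:R + 1) `^ q - (M - k.+1)%N%:R `^ q + ((k%:R + 1) `^ q - k%:R `^ q).
Proof.
move=> kM; pose g (l : nat) : R := `|l%:R - k%:R| `^ q - `|l%:R - k%:R - 1| `^ q.
rewrite -(big_mkord xpredT (fun l => second_difference (l%:R - k%:R))).
rewrite (eq_bigr (fun l => g l.+1 - g l)); last first.
  move=> l _; rewrite /second_difference /g -[l.+1%:R]natr1.
  have -> : l%:R + 1 - k%:R - 1 = l%:R - k%:R :> R by ring.
  have -> : l%:R + 1 - k%:R = l%:R - k%:R + 1 :> R by ring.
  by ring.
rewrite telescope_sumr// /g.
have -> : M%:R - k%:R = (M - k.+1)%N%:R + 1 :> R.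
  by rewrite natrB// -[k.+1%:R]natr1; ring.
have -> : 0 - k%:R - 1 = - (k%:R + 1) :> R by ring.
rewrite addrK sub0r !normrN !ger0_norm ?addr_ge0//.
by ring.
Qed.

(** Off the diagonal all terms have one sign. For [q <= 1] they are nonpositive while the whole row
    sum is nonnegative, so their absolute values add up to at most the diagonal term 2. For [q > 1]
    all terms are nonnegative and the telescoped sum is bounded by two increments of the power. *)
Lemma second_difference_abs_sum (M k : nat) : (k < M)%N -> q <= 2 ->
  \sum_(l < M) `|second_difference (l%:R - k%:R)| <=
    4 * M%:R `^ (q - Num.min q 1).
Proof.
move=> kM q2; have M0 : (0 < M)%N by exact: leq_ltn_trans kM.
have sd0 : second_difference 0 = 2.
  rewrite /second_difference add0r sub0r normrN normr1 normr0 powR0 ?gt_eqF// powR1.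
  by ring.
have dist (l : 'I_M) : l != Ordinal kM -> 1 <= `|l%:R - k%:R : R|.
  rewrite -val_eqE/= neq_ltn => /orP[lk|kl].
    rewrite distrC ger0_norm ?subr_ge0 ?ler_nat 1?ltnW//.
    by rewrite lerBrDl natr1 ler_nat.
  rewrite ger0_norm ?subr_ge0 ?ler_nat 1?ltnW//.
  by rewrite lerBrDl natr1 ler_nat.
have [q1|q1] := leP q 1.
  rewrite subrr powRr0 mulr1.
  have : 0 <= \sum_(l < M) second_difference (l%:R - k%:R).
    rewrite second_difference_sum//.
    by rewrite addr_ge0// subr_ge0 powR_homo_le ?(ltW q0)// lerDl.
  rewrite (bigD1 (Ordinal kM))//= [in X in _ -> X](bigD1 (Ordinal kM))//=.
  rewrite subrr sd0 [ `|2|]ger0_norm//.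
  rewrite [in X in _ -> X](eq_bigr (fun l : 'I_M => - second_difference (l%:R - k%:R))); last first.
    by move=> l lk; rewrite ler0_norm// second_difference_le0// dist.
  by rewrite sumrN; lra.
rewrite (eq_bigr (fun l : 'I_M => second_difference (l%:R - k%:R))); last first.
  move=> l _; have [->|lk] := eqVneq l (Ordinal kM).
    by rewrite subrr sd0 ger0_norm.
  by rewrite ger0_norm// second_difference_ge0 ?dist ?ltW.
rewrite second_difference_sum//.
have pw (a : nat) : (a < M)%N -> (a%:R + 1) `^ q - a%:R `^ q <= 2 * M%:R `^ (q - 1).
  move=> aM; apply: le_trans (powR_increment_le _ _ _) _ => //; first exact: ltW.
  rewrite ler_wpM2l//; apply: powR_homo_le; [lra|by rewrite addr_ge0|].
  by rewrite natr1 ler_nat.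
have h1 := pw _ kM.
have : (M - k.+1 < M)%N by rewrite ltn_subrL M0.
move=> /pw; lra.
Qed.

End PowerSecondDifference.

(** Schur test: [|b k * b l|] is at most the mean of the two squares, and symmetry of [G] turns both
    halves into row sums. *)
Lemma quadratic_form_le {R : realFieldType} (M : nat) (b : 'I_M -> R)
    (G : 'I_M -> 'I_M -> R) (K : R) : (forall k l, G k l = G l k) ->
  (forall k, \sum_(l < M) `|G k l| <= K) ->
  \sum_(k < M) \sum_(l < M) b k * b l * G k l <= K * \sum_(k < M) b k ^+ 2.
Proof.
move=> Gs GK.
apply: (@le_trans _ _ (\sum_(k < M) \sum_(l < M)
    (2^-1 * (b k ^+ 2 * `|G k l|) + 2^-1 * (b l ^+ 2 * `|G l k|)))).
  apply: ler_sum => k _; apply: ler_sum => l _.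
  rewrite (Gs l k) -mulrDr -mulrDl mulrA.
  apply: (le_trans (ler_norm _)); rewrite normrM ler_wpM2r// normrM.
  have := sqr_ge0 (`|b k| - `|b l|).
  by rewrite -(real_normK (num_real (b k))) -(real_normK (num_real (b l))); lra.
under eq_bigr do rewrite big_split/=.
rewrite big_split/= [X in _ + X]exchange_big/= -big_split/= mulr_sumr.
apply: ler_sum => k _; rewrite -mulr2n -[leLHS]mulr_natl -mulr_sumr -mulr_sumr.
rewrite mulVKf// [leRHS]mulrC.
by rewrite ler_wpM2l// sqr_ge0.
Qed.

(** * Covariance of the increments *)

Section FbmIncrements.
Context {d : measure_display} {T : measurableType d} {R : realType}.
Variable P : probability T R.
Variables (H : R) (W : R -> T -> R).
Hypotheses (H_gt0 : 0 < H) (H_lt1 : H < 1).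
Hypothesis fW : fractional_brownian_motion P H W.

Definition fbm_covariance (s t : R) : R :=
  2^-1 * (`|s| `^ (2 * H) + `|t| `^ (2 * H) - `|t - s| `^ (2 * H)).

Lemma fbm_measurable t : 0 <= t -> measurable_fun [set: T] (W t).
Proof.
move=> t0; have [gW _ _ _] := fW.
have [//|mW _] := gW 1%N (fun=> 1) (fun=> t).
by have -> // : W t = (fun w => \sum_(i < 1) 1 * W t w);
  apply/funext => w; rewrite big_ord1 mul1r.
Qed.

Lemma fbm_integral_mul s t : 0 <= s -> 0 <= t ->
  (\int[P]_w (W s w * W t w)%:E = (fbm_covariance s t)%:E)%E.
Proof. by move=> s0 t0; have [_ _ _] := fW => /(_ s t s0 t0); rewrite unlock. Qed.

Lemma fbm_integrable_mul s t : 0 <= s -> 0 <= t ->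
  P.-integrable [set: T] (fun w => (W s w * W t w)%:E).
Proof.
move=> s0 t0.
have sqr r : 0 <= r -> P.-integrable [set: T] (fun w => (W r w * W r w)%:E).
  move=> r0; apply/integrableP; split.
    by apply/measurable_EFinP; apply: measurable_funM; exact: fbm_measurable.
  under eq_integral do rewrite gee0_abs ?lee_fin ?sqr_ge0//.
  by rewrite fbm_integral_mul// ltry.
apply: (le_integrable _ _ _ (integrableD measurableT (sqr _ s0) (sqr _ t0))) => //.
  by apply/measurable_EFinP; apply: measurable_funM; exact: fbm_measurable.
move=> w _ /=; rewrite lee_fin [leRHS]ger0_norm ?addr_ge0 -?expr2 ?sqr_ge0//.
by rewrite ler_norml; apply/andP; split; nra.
Qed.

Lemma fbm_integral_sqr_sum (n : nat) (a t : 'I_n -> R) : (forall i, 0 <= t i) ->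
  (\int[P]_w ((\sum_(i < n) a i * W (t i) w) ^+ 2)%:E =
   (\sum_(i < n) \sum_(j < n) a i * a j * fbm_covariance (t i) (t j))%:E)%E.
Proof.
move=> t0.
under eq_integral.
  move=> w _.
  have -> : ((\sum_(i < n) a i * W (t i) w) ^+ 2)%:E =
      (\sum_(i < n) \sum_(j < n) (a i * a j)%:E * (W (t i) w * W (t j) w)%:E)%E.
    rewrite expr2 mulr_suml -sumEFin; apply: eq_bigr => i _.
    rewrite mulr_sumr -sumEFin; apply: eq_bigr => j _.
    by rewrite -EFinM; congr (_%:E); ring.
  over.
have int i j : P.-integrable [set: T]
    (fun w => (a i * a j)%:E * (W (t i) w * W (t j) w)%:E)%E.
  by apply: integrableZl => //; exact: fbm_integrable_mul.
rewrite integral_sum//; last by move=> i; apply: integrable_sum.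
rewrite -sumEFin; apply: eq_bigr => i _.
rewrite integral_sum// -sumEFin; apply: eq_bigr => j _.
rewrite integralZl//; last exact: fbm_integrable_mul.
by rewrite fbm_integral_mul// EFinM.
Qed.

Variables (s delta : R) (M : nat).
Hypotheses (s_ge0 : 0 <= s) (delta_gt0 : 0 < delta).

Let pt (k : nat) : R := s + k%:R * delta.

Let pt_ge0 k : 0 <= pt k.
Proof. by rewrite addr_ge0// mulr_ge0// ltW. Qed.

Definition weighted_increment (b : 'I_M -> R) (w : T) : R :=
  \sum_(k < M) b k * (W (s + k.+1%:R * delta) w - W (s + k%:R * delta) w).

(** Right ends of cells with weights [b], then left ends with weights [- b]: a linear combination of
    values of the process, as [gaussian_process] requires. *)
Let coef (b : 'I_M -> R) (i : 'I_(M + M)) : R :=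
  match fintype.split i with inl k => b k | inr k => - b k end.
Let time (i : 'I_(M + M)) : R :=
  match fintype.split i with inl k => pt k.+1 | inr k => pt k end.

Let weighted_incrementE b w :
  weighted_increment b w = \sum_(i < M + M) coef b i * W (time i) w.
Proof.
rewrite big_split_ord/= -big_split/=; apply: eq_bigr => k _.
by rewrite /coef /time !(unsplitK (inl k)) !(unsplitK (inr k)); ring.
Qed.

Let time_ge0 i : 0 <= time i.
Proof. by rewrite /time; case: fintype.split. Qed.

Lemma weighted_increment_gaussian b : gaussian_variable P (weighted_increment b).
Proof.
have [gW _ _ _] := fW.
by rewrite (funext (weighted_incrementE b)); exact: gW.
Qed.

(** In the covariance of two increments the terms depending on one time only cancel; scaling takes
    out the power of [delta]. *)
Lemma weighted_increment_sqr b :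
  (\int[P]_w ((weighted_increment b w) ^+ 2)%:E =
  (2^-1 * delta `^ (2 * H) * \sum_(k < M) \sum_(l < M)
     b k * b l * second_difference (2 * H) (l%:R - k%:R))%:E)%E.
Proof.
under eq_integral do rewrite weighted_incrementE.
rewrite fbm_integral_sqr_sum//; congr (_%:E).
have d0 := ltW delta_gt0.
have cov (i j : nat) : fbm_covariance (pt i) (pt j) =
   2^-1 * (`|pt i| `^ (2 * H) + `|pt j| `^ (2 * H) - delta `^ (2 * H) * `|j%:R - i%:R| `^ (2 * H)).
  rewrite /fbm_covariance; congr (_ * (_ - _)).
  rewrite -powRM//; congr (_ `^ _).
  have -> : pt j - pt i = delta * (j%:R - i%:R) by rewrite /pt; ring.
  by rewrite normrM (ger0_norm d0).
rewrite big_split_ord/= -big_split/= mulr_sumr; apply: eq_bigr => k _.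
rewrite !big_split_ord/= -!big_split/= mulr_sumr; apply: eq_bigr => l _.
rewrite /coef /time !(unsplitK (inl k)) !(unsplitK (inr k)) !(unsplitK (inl l)) !(unsplitK (inr l)).
rewrite !cov /second_difference.
rewrite -[l.+1%:R]natr1 -[k.+1%:R]natr1.
have -> : l%:R + 1 - (k%:R + 1) = l%:R - k%:R :> R by ring.
have -> : l%:R + 1 - k%:R = l%:R - k%:R + 1 :> R by ring.
have -> : l%:R - (k%:R + 1) = l%:R - k%:R - 1 :> R by ring.
by ring.
Qed.

(** The Schur bound, written with the total length [delta * M] so that the gain from refining the
    grid appears as the negative power of [M]. *)
Lemma weighted_increment_sqr_le b : (0 < M)%N ->
  (\int[P]_w ((weighted_increment b w) ^+ 2)%:E <=
  (2 * (delta * M%:R) `^ (2 * H) * M%:R `^ (- Num.min (2 * H) 1) *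
     \sum_(k < M) b k ^+ 2)%:E)%E.
Proof.
move=> M0; rewrite weighted_increment_sqr lee_fin.
have q0 : 0 < 2 * H by rewrite mulr_gt0.
have q2 : 2 * H <= 2 by rewrite ger_pMr// ltW.
have := @quadratic_form_le R M b (fun k l => second_difference (2 * H) (l%:R - k%:R))
  (4 * M%:R `^ (2 * H - Num.min (2 * H) 1)).
move=> h; apply: (le_trans (ler_wpM2l _ (h _ _))).
- by rewrite mulr_ge0 ?powR_ge0.
- by move=> k l; rewrite -second_differenceN opprB.
- by move=> k; apply: second_difference_abs_sum.
have Mgt : 0 < M%:R :> R by rewrite ltr0n.
rewrite powRM ?(ltW delta_gt0) ?ler0n// powRD; last first.
  by rewrite (gt_eqF Mgt) implybT.
by rewrite le_eqVlt; apply/orP; left; apply/eqP; field.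
Qed.

Lemma weighted_increment_tail b (V x : R) : (0 < M)%N -> 0 < V -> 0 <= x ->
  2 * (delta * M%:R) `^ (2 * H) * M%:R `^ (- Num.min (2 * H) 1) *
    \sum_(k < M) b k ^+ 2 <= V ->
  (P [set w | x <= weighted_increment b w]%R <=
    (3 * expR (- (normal_mass / 16 * x ^+ 2 / V)))%:E)%E.
Proof.
move=> M0 V0 x0 bV.
have := @gaussian_variable_tail _ _ _ P _ V x (weighted_increment_gaussian b) V0 x0.
have -> : weighted_increment b @^-1` `[x, +oo[ = [set w | x <= weighted_increment b w].
  by apply/seteqP; split => w /=; rewrite in_itv/= andbT.
by apply; apply: le_trans (weighted_increment_sqr_le _ M0) _; rewrite lee_fin.
Qed.

End FbmIncrements.

(** * Chaining *)

(* A point whose index on the grid of level i is e has index e./2 on the grid of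
   level i - 1, hence index e./2.*2 back on level i; at level 0 the reference
   point is the left end of the block. *)
Definition chain_base (i e : nat) : nat := if i is 0 then 0 else e./2.*2.

(** The cells between the reference point and the point of index [e]. Above level 0 this is the cell
    just before [e] if [e] is odd, and no cell if [e] is even. *)
Definition chain_link (i e q : nat) : bool := (chain_base i e <= q < e)%N.

Section ChainCount.
Variables (n i M : nat) (eu ev : 'I_n -> nat).
Hypothesis euv : forall j, (eu j <= ev j)%N.
Hypothesis euv_disj : forall j j', j != j' -> (ev j <= eu j')%N || (ev j' <= eu j)%N.

Lemma chain_base_le e : (chain_base i e <= e)%N.
Proof. by case: i => //= k; lia. Qed.

Lemma straddle_count_le1 q : (\sum_(j < n) (eu j <= q < ev j)%N <= 1)%N.
Proof.
have [[j hj]|no] := pselect (exists j, (eu j <= q < ev j)%N); last first.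
  by rewrite big1// => j _; apply/eqP; rewrite eqb0; apply/negP => h; apply: no; exists j.
rewrite (bigD1 j)//= hj big1// => j' j'j; apply/eqP; rewrite eqb0.
by have := euv_disj j'j; lia.
Qed.

(** The links of the two endpoints can differ at [q] only if the rounded interval contains cell [q]
    or cell [q.+1], and each cell lies in at most one rounded interval. *)
Lemma chain_link_count q :
  (\sum_(j < n) (chain_link i (ev j) q != chain_link i (eu j) q) <= 2)%N.
Proof.
apply: (@leq_trans (\sum_(j < n) ((eu j <= q < ev j) + (eu j <= q.+1 < ev j)))).
  apply: leq_sum => j _; have := euv j; rewrite /chain_link /chain_base.
  by case: i => [|k]; lia.
by rewrite big_split/= (leq_add (straddle_count_le1 q) (straddle_count_le1 q.+1)).
Qed.

Lemma chain_link_sum e : (\sum_(q < M) chain_link i.+1 e q <= 1)%N.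
Proof.
rewrite -(big_mkord xpredT (fun q => nat_of_bool (chain_link i.+1 e q))).
apply: (@leq_trans (\sum_(0 <= q < M) (q == e.-1))).
  by apply: leq_sum => q _; rewrite /chain_link/=; lia.
have -> : (\sum_(0 <= q < M) (q == e.-1) = (e.-1 < M))%N.
  by elim: M => [|m IH]; [rewrite big_geq|rewrite big_nat_recr//= IH; lia].
exact: leq_b1.
Qed.

End ChainCount.

Section ChainCoefficient.
Context {R : realType}.

(* Sign of each increment and rounded indices of its two endpoints. *)
Definition chain_config (n M : nat) := {ffun 'I_n -> bool * ('I_M.+1 * 'I_M.+1)}.

(** Weight of the increment over cell [q] in the level [i] correction of the signed sum. *)
Definition chain_coef (n i M : nat) (c : chain_config n M) (q : 'I_M) : R :=
  \sum_(j < n) (-1) ^+ (c j).1 *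
    ((chain_link i (c j).2.2 q)%:R - (chain_link i (c j).2.1 q)%:R).

Definition chain_energy (n i M : nat) (c : chain_config n M) : R :=
  \sum_(q < M) chain_coef i c q ^+ 2.

(** Each coefficient is at most [N q <= 2] in absolute value, so the energy is at most twice the sum
    of the [N q]. That sum is at most [2 * n]: at level 0 there are only [n] cells, and above it
    each of the [2 * n] endpoints contributes at most one cell. *)
Lemma chain_energy_le (n i : nat) (c : chain_config n (n * 2 ^ i)) :
  (forall j, (c j).2.1 <= (c j).2.2)%N ->
  (forall j j', j != j' -> ((c j).2.2 <= (c j').2.1) || ((c j').2.2 <= (c j).2.1))%N ->
  chain_energy i c <= 4 * n%:R.
Proof.
move: c; set M := (n * 2 ^ i)%N => c cle cdis.
pose N q := (\sum_(j < n) (chain_link i (c j).2.2 q != chain_link i (c j).2.1 q))%N.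
have N2 q : (N q <= 2)%N by apply: (@chain_link_count _ i (fun j => (c j).2.1) (fun j => (c j).2.2)).
have coefN (q : 'I_M) : `|chain_coef i c q| <= (N q)%:R.
  rewrite /N natr_sum; apply: (le_trans (ler_norm_sum _ _ _)).
  apply: ler_sum => j _; rewrite normrM normrX normrN1 expr1n mul1r.
  by do 2 case: chain_link; rewrite ?subrr ?subr0 ?sub0r ?normrN ?normr1 ?normr0.
have Nsum : (\sum_(q < M) N q <= 2 * n)%N.
  rewrite /M /N; case: (i) => [|k].
    apply: (@leq_trans (\sum_(q < n * 2 ^ 0) 2)); last by rewrite sum_nat_const card_ord; lia.
    apply: leq_sum => q _.
    exact: (@chain_link_count _ 0 (fun j => (c j).2.1) (fun j => (c j).2.2)).
  rewrite exchange_big/=.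
  apply: (@leq_trans (\sum_(j < n) 2)); last by rewrite sum_nat_const card_ord; lia.
  apply: leq_sum => j _.
  apply: (@leq_trans (\sum_(q < n * 2 ^ k.+1)
     (chain_link k.+1 (c j).2.2 q + chain_link k.+1 (c j).2.1 q))).
    by apply: leq_sum => q _; do 2 case: chain_link.
  by rewrite big_split/= (leq_add (chain_link_sum _ _ _) (chain_link_sum _ _ _)).
apply: (@le_trans _ _ (\sum_(q < M) (2 * N q)%:R)).
  apply: ler_sum => q _; rewrite -real_normK ?num_real//.
  apply: (@le_trans _ _ ((N q)%:R ^+ 2)); first by rewrite lerXn2r ?nnegrE.
  by rewrite -natrX ler_nat -mulnn leq_mul2r N2 orbT.
rewrite -natr_sum -big_distrr/= -natrM ler_nat.
by rewrite (_ : 4 * n = 2 * (2 * n))%N ?leq_mul2l//; lia.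
Qed.

Context {T : Type}.
Variable (W : R -> T -> R) (w : T).

Lemma chain_telescope (i M e : nat) (s delta : R) : (e <= M)%N ->
  \sum_(q < M) (chain_link i e q)%:R *
    (W (s + q.+1%:R * delta) w - W (s + q%:R * delta) w) =
  W (s + e%:R * delta) w - W (s + (chain_base i e)%:R * delta) w.
Proof.
move=> eM; pose g q := W (s + q%:R * delta) w.
rewrite -(big_mkord xpredT (fun q => (chain_link i e q)%:R * (g q.+1 - g q))).
rewrite (big_cat_nat (leq0n (chain_base i e)))/=; last first.
  exact: leq_trans (chain_base_le i e) eM.
rewrite big_nat big1 ?add0r; last first.
  by move=> q /andP[_ qb]; rewrite /chain_link leqNgt qb mul0r.
rewrite (big_cat_nat (chain_base_le i e) eM)/=.
rewrite [X in _ + X]big_nat [X in _ + X]big1 ?addr0; last first.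
  by move=> q /andP[eq _]; rewrite /chain_link [(q < e)%N]ltnNge eq andbF mul0r.
rewrite big_nat (eq_bigr (fun q => g q.+1 - g q)); last first.
  by move=> q qe; rewrite /chain_link qe mul1r.
by rewrite -big_nat telescope_sumr ?chain_base_le.
Qed.

End ChainCoefficient.

Lemma within_continuous_cvg {R : realType} (A : set R) (f : R -> R) (x : R)
    (y : nat -> R) : {within A, continuous f} -> A x -> (forall k, A (y k)) ->
  y @ \oo --> x -> f (y k) @[k --> \oo] --> f x.
Proof.
move=> /subspace_continuousP cf Ax Ay yx.
apply: (cvg_comp _ _ _ (cf x Ax)) => B /yx.
by rewrite /nbhs/=; apply: filterS => k /=; apply.
Qed.

Lemma cvg_sumr {R : realType} {U I : Type} (F : set_system U) {FF : Filter F}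
    (r : seq I) (P : pred I) (f : I -> U -> R) (a : I -> R) :
  (forall i, f i x @[x --> F] --> a i) ->
  \sum_(i <- r | P i) f i x @[x --> F] --> \sum_(i <- r | P i) a i.
Proof.
move=> fa; elim: r => [|i r IH].
  by rewrite big_nil; under eq_fun do rewrite big_nil; exact: cvg_cst.
rewrite big_cons; under eq_fun do rewrite big_cons.
by case: ifP => // _; exact: cvgD.
Qed.

Section Chaining.
Context {d : measure_display} {T : measurableType d} {R : realType}.
Variables (W : R -> T -> R) (w : T).
Variables (n : nat) (s L : R) (sgn : 'I_n -> bool) (u v : 'I_n -> R).
Hypotheses (n_gt0 : (0 < n)%N) (L_gt0 : 0 < L).
Hypothesis su : forall j, s <= u j.
Hypothesis uv : forall j, u j <= v j.
Hypothesis vL : forall j, v j <= s + L.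
Hypothesis uv_disj : forall j j', j != j' -> (v j <= u j') || (v j' <= u j).

Let M i := (n * 2 ^ i)%N.
Let delta i := L / (M i)%:R.
Let idx i t := Num.truncn ((t - s) / delta i).
Let Wk k t := W (s + (idx k t)%:R * delta k) w.

Let M_gt0 i : (0 < M i)%N. Proof. by rewrite /M muln_gt0 n_gt0 expn_gt0. Qed.

Let delta_gt0 i : 0 < delta i.
Proof. by rewrite divr_gt0// ltr0n. Qed.

Let idx_le i t t' : t <= t' -> (idx i t <= idx i t')%N.
Proof.
move=> tt'; apply: le_truncn; rewrite ler_wpM2r ?invr_ge0 ?(ltW (delta_gt0 i))//.
by rewrite lerB.
Qed.

Let idx_max i t : t <= s + L -> (idx i t <= M i)%N.
Proof.
move=> tL; rewrite -[leqRHS](@natrK R); apply: le_truncn.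
rewrite ler_pdivrMr// /delta mulrC divfK ?lerBlDl//.
by rewrite gt_eqF// ltr0n.
Qed.

(** The grids are nested, each cell being halved at the next level; for [t < s] both truncations are
    0. *)
Let idx_half i t : idx i t = (idx i.+1 t)./2.
Proof.
have [ts|st] := leP s t; last first.
  by rewrite /idx !truncn_floor !leNgt !pmulr_llt0 ?invr_gt0// subr_lt0 st.
apply/eqP; rewrite /idx truncn_eq; last by rewrite divr_ge0 ?subr_ge0// ltW.
have := truncn_itv (_ : 0 <= (t - s) / delta i.+1).
have -> : (t - s) / delta i.+1 = 2 * ((t - s) / delta i).
  rewrite /delta /M expnS mulnCA natrM; field.
  by rewrite (gt_eqF L_gt0)/= andbT !pnatr_eq0 -!lt0n expn_gt0 n_gt0.
set r := (t - s) / delta i; have r0 : 0 <= r by rewrite divr_ge0 ?subr_ge0// ltW.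
move=> /(_ (mulr_ge0 _ r0)) => /(_ (ler0n _ 2)).
set e := Num.truncn _ => /andP[e1 e2].
have h1 : (e./2 * 2 <= e)%N by lia.
have h2 : (e.+1 <= e./2.+1 * 2)%N by lia.
rewrite -(ler_nat R) natrM in h1; rewrite -(ler_nat R) natrM in h2.
apply/andP; split; lra.
Qed.

Let Wk_cvg t : {within `[0, +oo[, continuous (fun r => W r w)} -> 0 <= s -> s <= t ->
  Wk k t @[k --> \oo] --> W t w.
Proof.
move=> cW s0 st.
apply: (@within_continuous_cvg _ `[0, +oo[%classic (fun r => W r w) t
   (fun k => s + (idx k t)%:R * delta k)) => //=.
- by rewrite in_itv/= andbT (le_trans s0).
- by move=> k; rewrite in_itv/= andbT addr_ge0// mulr_ge0// ltW.
have bd k : t - delta k <= s + (idx k t)%:R * delta k <= t.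
  have := truncn_itv (_ : 0 <= (t - s) / delta k).
  rewrite -/(idx k t) => /(_ (divr_ge0 _ (ltW (delta_gt0 k)))).
  rewrite subr_ge0 => /(_ st) /andP[].
  by rewrite ler_pdivlMr// ltr_pdivrMr// -natr1; lra.
have d0 : delta k @[k --> \oo] --> (0 : R).
  have -> : delta = fun k => (L / n%:R) * 2^-1 ^+ k.
    apply/funext => k; rewrite /delta /M natrM natrX invfM exprVn mulrA//.
  rewrite -[0](mulr0 (L / n%:R)); apply: cvgMl_tmp => //.
  by apply: cvg_expr; rewrite ger0_norm ?invr_ge0// invf_lt1// ltr1n.
apply: (@squeeze_cvgr _ _ _ _ (fun k => t - delta k) (fun=> t)).
- by apply: nearW => k; exact: bd.
- by rewrite -[X in _ --> X]subr0; apply: cvgB => //; exact: cvg_cst.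
- exact: cvg_cst.
Qed.

Let cfg i : chain_config n (M i) :=
  [ffun j => (sgn j, (inord (idx i (u j)), inord (idx i (v j))))].

Let cfg_energy i : chain_energy i (cfg i) <= 4 * n%:R :> R.
Proof.
apply: chain_energy_le => [j|j j' jj']; rewrite !ffunE/= !inordK ?ltnS ?idx_max//.
- exact: idx_le.
- exact: le_trans (uv _) (vL _).
- by have /orP[h|h] := uv_disj jj'; rewrite (idx_le i h) ?orbT.
- exact: le_trans (uv _) (vL _).
- exact: le_trans (uv _) (vL _).
Qed.

(** The signed sum with all endpoints rounded down to the grid of level [k]; it is the sum of the
    corrections [D 0], ..., [D k]. *)
Let S k := \sum_(j < n) (-1) ^+ sgn j * (Wk k (v j) - Wk k (u j)).

Let D i := weighted_increment W s (delta i) (chain_coef i (cfg i)) w.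

Let DE i : D i = \sum_(j < n) (-1) ^+ sgn j *
   ((Wk i (v j) - W (s + (chain_base i (idx i (v j)))%:R * delta i) w) -
    (Wk i (u j) - W (s + (chain_base i (idx i (u j)))%:R * delta i) w)).
Proof.
rewrite /D /weighted_increment.
under eq_bigr do rewrite /chain_coef mulr_suml.
rewrite exchange_big/=; apply: eq_bigr => j _; rewrite ffunE/= !inordK ?ltnS ?idx_max//; last first.
  exact: le_trans (uv _) (vL _).
rewrite /Wk -(@chain_telescope _ _ W w i (M i) (idx i (v j)) s (delta i)) ?idx_max//.
rewrite -(@chain_telescope _ _ W w i (M i) (idx i (u j)) s (delta i)) ?idx_max//; last first.
  exact: le_trans (uv _) (vL _).
rewrite -sumrB mulr_sumr; apply: eq_bigr => q _; ring.
Qed.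

Let SE k : S k = \sum_(i < k.+1) D i.
Proof.
elim: k => [|k IH].
  (* At level 0 both endpoints refer to the left end of the block, and the reference values
     cancel. *)
  rewrite big_ord1 DE /S; apply: eq_bigr => j _ /=; congr (_ * _); ring.
rewrite big_ord_recr/= -IH DE /S -big_split/=; apply: eq_bigr => j _.
(* The reference point of level [k.+1] is the rounded point of level [k]. *)
have ev t : W (s + ((idx k.+1 t)./2.*2)%:R * delta k.+1) w = Wk k t.
  rewrite /Wk (idx_half k); congr (W (s + _) w).
  rewrite -muln2 natrM -mulrA; congr (_ * _).
  rewrite /delta /M expnS mulnCA natrM; field.
  by rewrite !pnatr_eq0 -!lt0n expn_gt0 n_gt0.
by rewrite !ev -mulrDr; congr (_ * _); ring.
Qed.

(** The hypothesis covers every configuration of low energy, hence the one given by the actual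
    roundings. This bounds all rounded sums by [y], and continuity of the path carries the bound to
    the limit. *)
Lemma chaining_le (x : nat -> R) (y : R) :
  {within `[0, +oo[, continuous (fun r => W r w)} -> 0 <= s ->
  (forall i (c : chain_config n (n * 2 ^ i)), chain_energy i c <= 4 * n%:R :> R ->
     weighted_increment W s (L / (n * 2 ^ i)%:R) (chain_coef i c) w < x i) ->
  (forall k, \sum_(i < k) x i <= y) ->
  \sum_(j < n) (-1) ^+ sgn j * (W (v j) w - W (u j) w) <= y.
Proof.
move=> cW s0 Hx xy.
have Slim : S k @[k --> \oo] -->
    \sum_(j < n) (-1) ^+ sgn j * (W (v j) w - W (u j) w).
  rewrite /S; apply: cvg_sumr => j; apply: cvgMl_tmp.
  apply: cvgB; apply: Wk_cvg => //.
  exact: le_trans (su _) (uv _).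
apply: (ler_cvg_to Slim (cvg_cst y)).
apply: nearW => k; rewrite SE; apply: le_trans (xy k.+1).
by apply: ler_sum => i _; apply: ltW; apply: Hx; exact: cfg_energy.
Qed.

End Chaining.

(** * Number of configurations against Gaussian decay *)

Section Entropy.
Context {R : realType}.

Lemma bernoulli_min (theta : R) (i : nat) : 1 <= theta ->
  Num.min 1 (theta - 1) * (1 + i%:R) <= theta ^+ i.
Proof.
move=> t1; set b := Num.min _ _.
have b1 : b <= 1 by rewrite ge_min lexx.
have b2 : b <= theta - 1 by rewrite ge_min lexx orbT.
elim: i => [|i IH]; first by rewrite addr0 mulr1 expr0.
have ti : 1 <= theta ^+ i by rewrite exprn_ege1.
rewrite exprS -natr1.
have : (theta - 1) * 1 <= (theta - 1) * theta ^+ i by rewrite ler_wpM2l// subr_ge0.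
lra.
Qed.

Lemma two_le_expR1 : 2 <= expR 1 :> R.
Proof. by have := expR_ge1Dx (1 : R); lra. Qed.

Lemma exp2_le_expR (m : nat) : 2 ^+ m <= expR m%:R :> R.
Proof.
rewrite -[m%:R]mul1r expRM_natr lerXn2r ?nnegrE ?expR_ge0//.
exact: two_le_expR1.
Qed.

Lemma ln_le_powR (h x : R) : 0 < h -> 1 <= x -> ln x <= 2 / h * x `^ (h / 2).
Proof.
move=> h0 x1; have x0 : 0 < x by rewrite (lt_le_trans ltr01).
rewrite -ler_pdivrMl ?divr_gt0// invf_div.
by rewrite -ln_powR; apply: ltW; apply: ln_sublinear; rewrite powR_gt0.
Qed.

(** For [z] the power [h / 2] of [n], the left side is at most [(4 + 4 / h) * z], and the right side
    is [a * z ^ 2]; [n0] is chosen to make [z] at least the ratio [y]. *)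
Lemma eventually_log_le_powR (h a : R) : 0 < h -> 0 < a ->
  exists2 n0 : nat, (0 < n0)%N &
    forall n : nat, (n0 <= n)%N -> 4 + 2 * ln n%:R <= a * n%:R `^ h.
Proof.
move=> h0 a0; pose y := (4 + 4 / h) / a.
have y0 : 0 < y by rewrite divr_gt0// addr_gt0// divr_gt0.
exists (Num.truncn (y `^ (2 / h))).+1 => // n n0n.
have n1 : 1 <= n%:R :> R by rewrite ler1n (leq_trans _ n0n).
have yn : y <= n%:R `^ (h / 2).
  have -> : y = (y `^ (2 / h)) `^ (h / 2).
    rewrite -powRrM (_ : 2 / h * (h / 2) = 1) ?powRr1 ?ltW//.
    by field; rewrite gt_eqF.
  apply: powR_homo_le; rewrite ?powR_ge0 ?divr_ge0 ?(ltW h0)//.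
  by apply: ltW; apply: lt_le_trans (truncnS_gt _) _; rewrite ler_nat.
have := ln_le_powR h0 n1; set z := _ `^ (h / 2) in yn * => lnz.
have -> : n%:R `^ h = z ^+ 2 :> R.
  rewrite -powR_mulrn ?powR_ge0// -powRrM; by congr (_ `^ _); field.
have z1 : 1 <= z.
  have -> : 1 = 1 `^ (h / 2) :> R by rewrite powR1.
  by rewrite powR_homo_le// divr_ge0// ltW.
have yaz : (4 + 4 / h) <= a * z.
  by rewrite [leRHS]mulrC -ler_pdivrMr.
have : (4 + 4 / h) * z <= (a * z) * z by rewrite ler_wpM2r//; lra.
have : 2 / h * z * 2 = 4 / h * z by ring.
by rewrite expr2; lra.
Qed.

(** By Bernoulli's inequality the Gaussian exponent is at least [2 * a' * N * (1 + i)], where [N] is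
    the power [1 + h] of [n]. One half absorbs the logarithm of the number of configurations and the
    factor [2 ^ i.+1], which makes the levels summable; the other half is the final bound. *)
Lemma entropy_exp_le (h a theta : R) : 0 < h -> 0 < a -> 1 < theta ->
  exists a' : R, exists n0 : nat, [/\ 0 < a', (0 < n0)%N &
    forall n i : nat, (n0 <= n)%N ->
      (8 * (n * 2 ^ i)%:R ^+ 2) ^+ n * expR (- (a * n%:R `^ (1 + h) * theta ^+ i)) <=
      expR (- (a' * n%:R `^ (1 + h))) / (2 ^ i.+1)%:R].
Proof.
move=> h0 a0 t1; set b := Num.min 1 (theta - 1).
have b0 : 0 < b by rewrite lt_min ltr01 subr_gt0.
have a'0 : 0 < a * b / 2 by rewrite divr_gt0// mulr_gt0.
have [n0 n00 Hn0] := eventually_log_le_powR h0 a'0.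
exists (a * b / 2), n0; split => // n i n0n.
have {Hn0}Hn := Hn0 _ n0n.
have n1 : 1 <= n%:R :> R by rewrite ler1n (leq_trans _ n0n).
have ngt : 0 < n%:R :> R by rewrite (lt_le_trans ltr01).
have ln0 : 0 <= ln n%:R :> R by rewrite ln_ge0.
set l := ln n%:R in Hn ln0; set a' := a * b / 2 in a'0 Hn *.
have base : 8 * (n * 2 ^ i)%:R ^+ 2 <= expR (3 + 2 * l + 2 * i%:R) :> R.
  have e1 : expR (2 * l) = n%:R ^+ 2 by rewrite mulrC expRM_natr lnK// posrE.
  have e2 : (2 ^+ i) ^+ 2 <= expR (2 * i%:R) :> R.
    by rewrite [leRHS](_ : _ = expR i%:R ^+ 2) ?lerXn2r ?nnegrE ?exprn_ge0 ?expR_ge0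
      ?exp2_le_expR// mulrC expRM_natr.
  have e3 : 8 <= expR 3 :> R by apply: le_trans (exp2_le_expR 3); rewrite -natrX.
  rewrite (expRD (3 + 2 * l)) (expRD 3) e1 natrM natrX exprMn [8 * _]mulrA.
  by rewrite ler_pM ?mulr_ge0 ?exprn_ge0// ler_wpM2r// exprn_ge0.
have tail : (2 ^ i.+1)%:R <= expR (i.+1%:R) :> R by rewrite natrX exp2_le_expR.
rewrite ler_pdivlMr ?ltr0n ?expn_gt0//.
set N := n%:R `^ (1 + h).
have NE : N = n%:R * n%:R `^ h.
  by rewrite /N powRD ?powRr1 ?(ltW ngt)// (gt_eqF ngt) implybT.
have N0 : 0 <= N by rewrite powR_ge0.
apply: (@le_trans _ _ (expR (3 + 2 * l + 2 * i%:R) ^+ n *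
   expR (- (a * N * theta ^+ i)) * expR i.+1%:R)).
  rewrite ler_pM ?mulr_ge0 ?exprn_ge0 ?expR_ge0 ?mulr_ge0//.
  rewrite ler_wpM2r ?expR_ge0// lerXn2r ?nnegrE ?mulr_ge0 ?expR_ge0 ?exprn_ge0//.
rewrite -expRM_natr -!expRD ler_expR.
have i0 : 0 <= i%:R :> R by [].
have B : a * N * (b * (1 + i%:R)) <= a * N * theta ^+ i.
  by rewrite ler_wpM2l ?mulr_ge0 ?(ltW a0)// bernoulli_min// ltW.
have B' : a * N * (b * (1 + i%:R)) = 2 * (a' * N * (1 + i%:R)) by rewrite /a'; field.
have A : n%:R * (4 + 2 * l) <= a' * N.
  by rewrite NE mulrCA ler_wpM2l.
have A1 : n%:R * (4 + 2 * l) * (1 + i%:R) <= a' * N * (1 + i%:R).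
  by rewrite ler_wpM2r// addr_ge0.
have A2 : a' * N <= a' * N * (1 + i%:R).
  by have := mulr_ge0 (mulr_ge0 (ltW a'0) N0) i0; lra.
have A3 : 0 <= n%:R * l * i%:R by rewrite !mulr_ge0.
have A4 : 1 + i%:R <= n%:R * (1 + i%:R) :> R by rewrite ler_peMl// addr_ge0.
have A5 : 0 <= n%:R * i%:R :> R by rewrite mulr_ge0.
rewrite -natr1; lra.
Qed.

End Entropy.

(** * Crossings of one block *)

Lemma probability_bigsetU_le {d : measure_display} {T : measurableType d} {R : realType}
    (P : probability T R) (I : finType) (F : I -> set T) (b : R) :
  (forall i, measurable (F i)) -> (forall i, (P (F i) <= b%:E)%E) ->
  (P (\big[setU/set0]_i F i) <= (#|I|%:R * b)%:E)%E.
Proof.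
move=> mF Fb; have -> : #|I| = size (index_enum I) by rewrite -sum1_size -sum1_card; exact: eq_bigl.
elim: (index_enum I) => [|i r IH]; first by rewrite big_nil measure0 mul0r.
rewrite big_cons/= -natr1 mulrDl mul1r [X in X%:E]addrC EFinD.
apply: (le_trans (measureU2 _ _ _)); rewrite ?leeD//; [exact: bigsetU_measurable|exact: Fb].
Qed.

Section BlockEvent.
Context {R : realType}.
Variable H : R.
Hypotheses (H_gt0 : 0 < H) (H_lt1 : H < 1).

Definition hurst_exponent : R := Num.min (2 * H) 1.
Local Notation h := hurst_exponent.

(* From one level to the next the variance is divided by 2^h and the squared
   threshold by theta = 2^(h/2), so the Gaussian exponent is multiplied by theta. *)
Definition level_growth : R := 2 `^ (h / 2).
Local Notation theta := level_growth.

Definition level_decay : R := (Num.sqrt theta)^-1.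
Local Notation rho := level_decay.

(** In units of [c]. The factor [(1 - rho) / 2] normalizes the geometric series to [n / 2], half of
    the total displacement of a packing of size [n]. *)
Definition level_threshold (n i : nat) : R := (1 - rho) / 2 * n%:R * rho ^+ i.

Lemma hurst_exponent_gt0 : 0 < h.
Proof. by rewrite lt_min ltr01 mulr_gt0. Qed.

Lemma level_growth_gt1 : 1 < theta.
Proof.
rewrite /level_growth /powR pnatr_eq0/= expR_gt1 mulr_gt0 ?ln_gt0 ?ltr1n//.
by rewrite divr_gt0// hurst_exponent_gt0.
Qed.

Lemma level_growth_gt0 : 0 < theta.
Proof. exact: lt_trans ltr01 level_growth_gt1. Qed.

Lemma level_growth_sqr : 2 `^ h = theta ^+ 2.
Proof.
rewrite -powR_mulrn ?ltW ?level_growth_gt0// /theta -powRrM; congr (_ `^ _).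
by rewrite divfK.
Qed.

Lemma level_decay_sqr : rho ^+ 2 = theta^-1.
Proof. by rewrite exprVn sqr_sqrtr// ltW// level_growth_gt0. Qed.

Lemma level_decay_itv : 0 < rho < 1.
Proof.
rewrite invr_gt0 sqrtr_gt0 level_growth_gt0/= invf_lt1 ?sqrtr_gt0 ?level_growth_gt0//.
by rewrite -{1}sqrtr1 ltr_sqrt ?level_growth_gt1// level_growth_gt0.
Qed.

Lemma level_threshold_ge0 n i : 0 <= level_threshold n i.
Proof.
have /andP[r0 r1] := level_decay_itv.
by rewrite !mulr_ge0 ?exprn_ge0 ?(ltW r0)// subr_ge0 ltW.
Qed.

Lemma level_threshold_sum n k : \sum_(i < k) level_threshold n i <= n%:R / 2.
Proof.
have /andP[r0 r1] := level_decay_itv.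
have -> : \sum_(i < k) level_threshold n i = n%:R / 2 * (1 - rho ^+ k).
  elim: k => [|k IH]; first by rewrite big_ord0 expr0 subrr mulr0.
  by rewrite big_ord_recr/= IH exprS /level_threshold; field.
by rewrite ler_piMr// gerBl exprn_ge0// ltW.
Qed.

Section Event.
Context {d : measure_display} {T : measurableType d}.
Variables (P : probability T R) (W : R -> T -> R).

(** The positions of the intervals depend on the path; ranging over the finitely many possible
    roundings gives a measurable event and a union bound. *)
Definition chain_event (s L : R) (n i : nat) (x : R) : set T :=
  \big[setU/set0]_(c : chain_config n (n * 2 ^ i))
    if chain_energy i c <= 4 * n%:R :> R then
      [set w | x <= weighted_increment W s (L / (n * 2 ^ i)%:R) (chain_coef i c) w]
    else set0.

Definition block_event (s L c : R) (n : nat) : set T :=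
  \bigcup_i chain_event s L n i (c * level_threshold n i).

Lemma not_block_event s L c n w : ~ block_event s L c n w ->
  forall i (b : chain_config n (n * 2 ^ i)), chain_energy i b <= 4 * n%:R :> R ->
     weighted_increment W s (L / (n * 2 ^ i)%:R) (chain_coef i b) w <
       c * level_threshold n i.
Proof.
move=> nw i b eb; rewrite ltNge; apply/negP => le; apply: nw; exists i => //.
by rewrite /chain_event (bigD1 b)//= eb; left.
Qed.

Hypothesis fW : fractional_brownian_motion P H W.

Lemma chain_event_measurable s L n i x : 0 <= s -> 0 < L -> (0 < n)%N ->
  measurable (chain_event s L n i x).
Proof.
move=> s0 L0 n0; apply: bigsetU_measurable => c _; case: ifP => // _.
have d0 : 0 < L / (n * 2 ^ i)%:R by rewrite divr_gt0// ltr0n muln_gt0 n0 expn_gt0.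
have [mX _] := weighted_increment_gaussian fW s0 d0 (chain_coef (R := R) i c).
rewrite -[X in measurable X]setTI; apply: measurable_fun_le => //.
Qed.

Lemma chain_event_probability s L c n i : 0 <= s -> 0 < L -> 0 < c -> (0 < n)%N ->
  L `^ (2 * H) = c ^+ 2 ->
  (P (chain_event s L n i (c * level_threshold n i)) <=
    (3 * ((8 * (n * 2 ^ i)%:R ^+ 2) ^+ n *
      expR (- (normal_mass * ((1 - rho) / 2) ^+ 2 / 128 *
              n%:R `^ (1 + h) * theta ^+ i))))%:E)%E.
Proof.
move=> s0 L0 c0 n0 Lc; set M := (n * 2 ^ i)%N.
have M0 : (0 < M)%N by rewrite muln_gt0 n0 expn_gt0.
have MR : 0 < M%:R :> R by rewrite ltr0n.
have nR : 0 < n%:R :> R by rewrite ltr0n.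
have d0 : 0 < L / M%:R by rewrite divr_gt0.
(* The variance bound of [weighted_increment_tail] for energy [4 * n], with [c ^+ 2] for the power
   [2 * H] of the block length. *)
pose V := 8 * c ^+ 2 * n%:R * M%:R `^ (- h).
have V0 : 0 < V by rewrite !mulr_gt0 ?exprn_gt0 ?powR_gt0.
have /andP[r0 r1] := level_decay_itv.
set e := expR _.
(* The squared threshold carries the factor [theta ^- i] and the variance [theta ^- (2 i)], which
   leaves [theta ^+ i]; likewise [n ^ 2] over [n ^ (1 - h)] leaves the power [1 + h]. The constant
   128 is 16 times 8. *)
have He : expR (- (normal_mass / 16 * (c * level_threshold n i) ^+ 2 / V)) = e.
  congr (expR (- _)); rewrite /V powRN.
  have -> : M%:R `^ h = n%:R `^ h * (theta ^+ i) ^+ 2 :> R.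
    rewrite natrM powRM// natrX -powR_mulrn// powRAC level_growth_sqr.
    by rewrite powR_mulrn ?exprn_ge0 ?ltW ?level_growth_gt0// exprAC.
  have -> : n%:R `^ (1 + h) = n%:R * n%:R `^ h :> R.
    by rewrite powRD ?powRr1 ?(ltW nR)// (gt_eqF nR) implybT.
  rewrite /level_threshold !exprMn -[(rho ^+ i) ^+ 2]exprAC level_decay_sqr exprVn.
  rewrite [theta^-1 ^+ i]exprVn.
  have := exprn_gt0 i level_growth_gt0; move: (theta ^+ i) => t t0.
  have := powR_gt0 h nR; move: (n%:R `^ h) => nh nh0.
  by field; rewrite !gt_eqF.
have cx : 0 <= c * level_threshold n i by rewrite mulr_ge0 ?level_threshold_ge0// ltW.
apply: le_trans (probability_bigsetU_le (b := 3 * e) _ _) _.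
- move=> b; case: ifP => // _.
  have [mX _] := weighted_increment_gaussian fW s0 d0 (chain_coef (R := R) i b).
  by rewrite -[X in measurable X]setTI; apply: measurable_fun_le.
- move=> b; case: ifP => eb; last by rewrite measure0 lee_fin mulr_ge0// expR_ge0.
  rewrite -He; apply: (weighted_increment_tail H_gt0 H_lt1 fW) => //.
  rewrite divfK ?gt_eqF// Lc /V -/h.
  rewrite [leRHS](_ : _ = 2 * c ^+ 2 * M%:R `^ (- h) * (4 * n%:R)); last by ring.
  by rewrite ler_wpM2l// !mulr_ge0 ?powR_ge0// ?exprn_ge0// ltW.
rewrite lee_fin mulrCA ler_wpM2l// ler_wpM2r ?expR_ge0//.
(* There are [2 * (M + 1) ^ 2] choices per interval, at most [8 * M ^ 2] since [M >= 1]. *)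
rewrite card_ffun !card_prod card_bool !card_ord natrX lerXn2r ?nnegrE ?mulr_ge0 ?exprn_ge0//.
rewrite -natrX -natrM ler_nat -mulnn; rewrite -/M.
by move: (M) M0 => m; nia.
Qed.

End Event.

(** The constants are chosen before the probability space, so they depend on [H] only. The relation
    between [L] and [c] says that an increment over a whole block has standard deviation [c]. *)
Lemma block_event_probability :
  exists a : R, exists n0 : nat, [/\ 0 < a, (0 < n0)%N &
    forall (d : measure_display) (T : measurableType d) (P : probability T R)
      (W : R -> T -> R), fractional_brownian_motion P H W ->
    forall (s L c : R) (n : nat), 0 <= s -> 0 < L -> 0 < c -> (n0 <= n)%N ->
      L `^ (2 * H) = c ^+ 2 ->
      measurable (block_event W s L c n) /\
      (P (block_event W s L c n) <= (3 * expR (- (a * n%:R `^ (1 + h))))%:E)%E].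
Proof.
have /andP[r0 r1] := level_decay_itv.
have a0 : 0 < normal_mass * ((1 - rho) / 2) ^+ 2 / 128 :> R.
  by rewrite divr_gt0// mulr_gt0 ?normal_mass_gt0// exprn_gt0// divr_gt0// subr_gt0.
have [a [n0 [a'0 n00 ent]]] := entropy_exp_le hurst_exponent_gt0 a0 level_growth_gt1.
exists a, n0; split => // d T P W fW s L c n s0 L0 c0 n0n Lc.
have ngt : (0 < n)%N by exact: leq_trans n00 n0n.
have mC i : measurable (chain_event W s L n i (c * level_threshold n i)).
  exact: (chain_event_measurable fW).
have mB : measurable (block_event W s L c n) by exact: bigcupT_measurable.
split => //.
apply: (le_trans (generalized_Boole_inequality _ _ _)) => //.
apply: (@le_trans _ _ (\sum_(i <oo)
    ((3 * expR (- (a * n%:R `^ (1 + h)))) / (2 ^ i.+1)%:R)%:E)%E).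
  apply: lee_nneseries => // i _.
  apply: le_trans (chain_event_probability _ _ _ _ _ _ _) _ => //.
  by rewrite lee_fin -[leRHS]mulrA ler_wpM2l// ent.
(* The weights [1 / 2 ^ i.+1] of the levels add up to 1. *)
by apply: epsilon_trick0; rewrite mulr_ge0// expR_ge0.
Qed.

End BlockEvent.

(** * Level crossings and packings of intervals *)

Section Counting.
Context {R : realType} {T : choiceType}.
Implicit Types (A : set T) (l : seq T).

Lemma countingE_esum A : counting A = (\esum_(x in A) 1%:E)%E :> \bar R.
Proof.
rewrite /counting; case: asboolP => fA.
  by rewrite esum_fset// fsbig_finite//= card_fset_sum1 natr_sum -sumEFin.
apply/esym/eqyP => r r0.
have [B BA Bn] := infinite_set_fset (Num.truncn r).+1 fA.
apply: esum_ge; exists [set` B] => //.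
apply: (@le_trans _ _ (Num.truncn r).+1%:R%:E).
  by rewrite lee_fin ltW// truncnS_gt.
rewrite fsbig_finite//= set_fsetK sumEFin lee_fin.
by move: Bn; rewrite card_fset_sum1 -(@ler_nat R) natr_sum.
Qed.

Lemma counting_bigcup (K : choiceType) (J : K -> set T) : trivIset [set: K] J ->
  counting (\bigcup_k J k) = (\esum_(k in [set: K]) counting (J k))%E :> \bar R.
Proof.
move=> tJ; rewrite countingE_esum; under [RHS]eq_esum do rewrite countingE_esum.
rewrite esum_esum//.
apply: (@reindex_esum R _ _ ([set: K] `*`` J) _ snd); split => //=.
- by move=> [k x] [_ /= Jx]; exists k.
- move=> [k x] [k' x']; move=> /set_mem[_ /= Jx] /set_mem[_ /= Jx'] xx'.
  by congr (_, _) => //; apply: tJ => //; exists x; split => //; rewrite xx'.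
- by move=> x [k _ Jx]; exists (k, x).
Qed.

Lemma counting_ge A l : uniq l -> (forall x, x \in l -> A x) ->
  ((size l)%:R%:E <= counting A :> \bar R)%E.
Proof.
move=> ul lA; rewrite /counting; case: asboolP => [fA|_]; last by rewrite leey.
rewrite lee_fin ler_nat uniq_leq_size// => x /lA Ax.
by rewrite in_fset_set//; apply/mem_set.
Qed.

Lemma counting_le A (k : nat) : (k%:R%:E <= counting A :> \bar R)%E ->
  exists l, [/\ uniq l, size l = k & forall x, x \in l -> A x].
Proof.
rewrite /counting; case: asboolP => [fA|iA] kA.
  move: kA; rewrite lee_fin ler_nat => kA.
  exists (take k (fset_set A)); split.
  - by rewrite take_uniq// fset_uniq.
  - by rewrite size_takel.
  - by move=> x /mem_take; rewrite in_fset_set// => /set_mem.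
have [B BA Bk] := infinite_set_fset k iA.
exists (take k B); split.
- by rewrite take_uniq// fset_uniq.
- by rewrite size_takel.
- by move=> x /mem_take xB; exact: BA.
Qed.

(** If one of the sets is infinite it supplies all [k] elements alone; otherwise the two finite
    lists are concatenated. *)
Lemma counting_addP A B (k : nat) : A `&` B = set0 ->
  (k%:R%:E <= counting A + counting B :> \bar R)%E <->
  exists l, [/\ uniq l, size l = k & forall x, x \in l -> A x \/ B x].
Proof.
move=> AB0; split=> [kAB|[l [ul sl lAB]]]; last first.
  pose a := fun x => x \in A.
  rewrite -sl -(perm_size (permEl (perm_filterC a l))) size_cat natrD EFinD leeD//.
    apply: counting_ge; rewrite ?filter_uniq// => x.
    by rewrite mem_filter => /andP[/set_mem].
  apply: counting_ge; rewrite ?filter_uniq// => x.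
  by rewrite mem_filter => /andP[/negP nA] /lAB[/mem_set|].
have cE (D : set T) : counting D = +oo%E :> \bar R \/ exists m : nat, counting D = m%:R%:E :> \bar R.
  rewrite /counting; case: asboolP => fD; [right|by left].
  by exists #|` fset_set D|%fset.
have incl (D : set T) m : (m%:R%:E <= counting D :> \bar R)%E ->
    (forall x, D x -> A x \/ B x) ->
    exists l, [/\ uniq l, size l = m & forall x, x \in l -> A x \/ B x].
  by move=> /counting_le[l [ul sl lD]] DAB; exists l; split => // x /lD /DAB.
have [Aoo|[m Am]] := cE A.
  by apply: (incl A); [rewrite Aoo leey|left].
have [Boo|[m' Bm]] := cE B.
  by apply: (incl B); [rewrite Boo leey|right].
have [l [ul sl lA]] : exists l, [/\ uniq l, size l = m & forall x, x \in l -> A x].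
  by apply: counting_le; rewrite Am.
have [l' [ul' sl' lB]] : exists l, [/\ uniq l, size l = m' & forall x, x \in l -> B x].
  by apply: counting_le; rewrite Bm.
have km : (k <= size (l ++ l'))%N.
  by move: kAB; rewrite Am Bm -EFinD lee_fin -natrD ler_nat size_cat sl sl'.
exists (take k (l ++ l')); split.
- rewrite take_uniq// cat_uniq ul ul' andbT; apply/hasPn => x /lB Bx.
  apply/negP => /lA Ax; have : (A `&` B) x by [].
  by rewrite AB0.
- by rewrite size_takel.
- by move=> x /mem_take; rewrite mem_cat => /orP[/lA|/lB]; [left|right].
Qed.

End Counting.

Section Crossings.
Context {R : realType}.
Implicit Types (s t c rho : R) (f g : R -> R).

Definition upcrossing_set s t c f : set (R * R) :=
  [set uv : R * R |
    [/\ s <= uv.1, uv.1 < uv.2, uv.2 <= t, f uv.1 = 0 & f uv.2 = c] /\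
    forall r, uv.1 < r < uv.2 -> 0 < f r < c].

Definition downcrossing_set s t c f : set (R * R) :=
  [set uv : R * R |
    [/\ s <= uv.1, uv.1 < uv.2, uv.2 <= t, f uv.1 = c & f uv.2 = 0] /\
    forall r, uv.1 < r < uv.2 -> 0 < f r < c].

Definition level_upcrossing_set s t c f : set (R * R) :=
  \bigcup_(p in [set: int]) upcrossing_set s t c (fun u => f u - p%:~R * c).

Definition level_downcrossing_set s t c f : set (R * R) :=
  \bigcup_(p in [set: int]) downcrossing_set s t c (fun u => f u - p%:~R * c).

(** The value of [f] at the left end of a crossing determines [p], so the sets for different levels
    are disjoint and the sum over [p] counts their union. *)
Lemma level_crossingsE s t c f : 0 < c -> level_crossings s t c f =
  (counting (level_upcrossing_set s t c f) + counting (level_downcrossing_set s t c f))%E.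
Proof.
move=> c0; rewrite /level_crossings /strip_crossings esumD; last 2 first.
  by move=> p _; rewrite /upcrossings countingE_esum esum_ge0.
  by move=> p _; rewrite /downcrossings countingE_esum esum_ge0.
have inj (p q : int) (x : R) y : x - p%:~R * c = y -> x - q%:~R * c = y -> p = q.
  move=> <- /eqP; rewrite (inj_eq (addrI _)) eqr_opp => /eqP.
  by move=> /(mulIf (lt0r_neq0 c0)) /intr_inj.
congr (_ + _)%E; rewrite -counting_bigcup//.
- by move=> p q _ _ [uv [[[_ _ _ h1 _] _] [[_ _ _ h2 _] _]]]; exact: inj h1 h2.
- by move=> p q _ _ [uv [[[_ _ _ h1 _] _] [[_ _ _ h2 _] _]]]; exact: inj h1 h2.
Qed.

Lemma level_crossing_sets_disjoint s t c f : 0 < c ->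
  level_upcrossing_set s t c f `&` level_downcrossing_set s t c f = set0.
Proof.
move=> c0; apply/seteqP; split => // -[u v] [[p _ [[_ _ _ up vp] _]]].
move=> [q _ [[_ _ _ uq vq] _]] /=; move: up vp uq vq => /= up vp uq vq.
have : (p - q)%:~R * c = c by rewrite intrB; lra.
have : (q - p)%:~R * c = c by rewrite intrB; lra.
rewrite !intrB => h1 h2; lra.
Qed.

Lemma level_crossings_geP s t c f (n : nat) : 0 < c ->
  (n%:R%:E <= level_crossings s t c f)%E <->
  exists l : seq (R * R), [/\ uniq l, size l = n &
    forall uv, uv \in l -> level_upcrossing_set s t c f uv \/
                          level_downcrossing_set s t c f uv].
Proof.
move=> c0; rewrite level_crossingsE//; apply: counting_addP.
exact: level_crossing_sets_disjoint.
Qed.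

(** Nothing is asked of [f] inside the intervals: only its values at finitely many times enter,
    which suits both chaining and measurability. *)
Definition crossing_packing s t c rho f (n : nat) (u v : 'I_n -> R) : Prop :=
  [/\ forall j, s <= u j, forall j, u j < v j, forall j, v j <= t &
     forall j j', j != j' -> (v j <= u j') || (v j' <= u j)] /\
  forall j, (exists p : int, f (u j) = rho + p%:~R * c) /\ `|f (v j) - f (u j)| = c.

(** Upward and downward crossings of the strip above level [p] of the grid shifted by [rho]. *)
Definition elementary_crossing s t c rho f (uv : R * R) (p : int) : Prop :=
  [/\ s <= uv.1, uv.1 < uv.2, uv.2 <= t,
    (f uv.1 = rho + p%:~R * c /\ f uv.2 = rho + (p + 1)%:~R * c) \/
    (f uv.2 = rho + p%:~R * c /\ f uv.1 = rho + (p + 1)%:~R * c) &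
    forall r, uv.1 < r < uv.2 -> rho + p%:~R * c < f r < rho + (p + 1)%:~R * c].

Lemma level_crossing_elementary s t c rho f uv : 
  level_upcrossing_set s t c (fun u => f u - rho) uv \/
    level_downcrossing_set s t c (fun u => f u - rho) uv <->
  exists p, elementary_crossing s t c rho f uv p.
Proof.
have e p x : (x - rho - p%:~R * c = 0 <-> x = rho + p%:~R * c) /\
   (x - rho - p%:~R * c = c <-> x = rho + (p + 1)%:~R * c) by rewrite intrD; split; split; lra.
have e2 p x : 0 < x - rho - p%:~R * c < c = (rho + p%:~R * c < x < rho + (p + 1)%:~R * c).
  by rewrite intrD; apply/idP/idP => /andP[h1 h2]; apply/andP; split; lra.
split=> [[[p _ [[su uv' vt fu fv] h]]|[p _ [[su uv' vt fu fv] h]]]|[p [su uv' vt fuv h]]].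
- exists p; split => //; last by move=> r /h; rewrite e2.
  by left; split; [apply/(e p _).1|apply/(e p _).2].
- exists p; split => //; last by move=> r /h; rewrite e2.
  by right; split; [apply/(e p _).1|apply/(e p _).2].
- case: fuv => -[f1 f2]; [left|right]; exists p => //; split => //.
  + by split => //; [apply/(e p _).1|apply/(e p _).2].
  + by move=> r /h; rewrite e2.
  + by split => //; [apply/(e p _).2|apply/(e p _).1].
  + by move=> r /h; rewrite e2.
Qed.

(* Values strictly between two consecutive grid levels are off the grid, so
   no endpoint of a crossing lies inside another crossing. *)
Lemma elementary_crossing_disjoint s t c rho f uv uv' p p' : 0 < c ->
  elementary_crossing s t c rho f uv p -> elementary_crossing s t c rho f uv' p' ->
  uv != uv' -> (uv.2 <= uv'.1) || (uv'.2 <= uv.1).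
Proof.
move=> c0.
have off (x : R) (q : int) uv1 p1 : elementary_crossing s t c rho f uv1 p1 ->
    f x = rho + q%:~R * c -> ~~ (uv1.1 < x < uv1.2).
  move=> [_ _ _ _ h] fx; apply/negP => /h; rewrite fx !ltrD2l !ltr_pM2r// !ltr_int.
  by rewrite ltzD1 => /andP[] /lt_le_trans/[apply]; rewrite ltxx.
have ends uv1 p1 : elementary_crossing s t c rho f uv1 p1 ->
    exists q1 q2 : int, f uv1.1 = rho + q1%:~R * c /\ f uv1.2 = rho + q2%:~R * c.
  by move=> [_ _ _ [[h1 h2]|[h1 h2]] _]; [exists p1, (p1 + 1)|exists (p1 + 1), p1].
move=> E E'; have [q1 [q2 [g1 g2]]] := ends _ _ E; have [q1' [q2' [g1' g2']]] := ends _ _ E'.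
move: (off _ _ _ _ E g1') (off _ _ _ _ E g2') (off _ _ _ _ E' g1) (off _ _ _ _ E' g2).
case: E => _ l _ _ _; case: E' => _ l' _ _ _.
move: uv uv' l l' {g1 g2 g1' g2'} => [u v] [u' v'] /= l l'.
rewrite !negb_and -!leNgt => /orP h1 /orP h2 /orP h3 /orP h4 ne.
rewrite -[X in is_true X]negbK; apply/negP; rewrite negb_or -!ltNge => /andP[a b].
have uu : u = u' by apply/eqP; rewrite eq_le; apply/andP; split; lra.
have vv : v = v' by apply/eqP; rewrite eq_le; apply/andP; split; lra.
by move: ne; rewrite /= uu vv !eqxx.
Qed.

Lemma packing_of_level_crossings s t c rho f (n : nat) : 0 < c ->
  (n%:R%:E <= level_crossings s t c (fun u => (f u - rho)%R))%E ->
  exists u v : 'I_n -> R, crossing_packing s t c rho f u v.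
Proof.
move=> c0 /(level_crossings_geP _ _ _ _ c0)[l [ul sl lE]].
have El j : (j < n)%N -> exists p, elementary_crossing s t c rho f (nth (0, 0) l j) p.
  by move=> jn; apply/level_crossing_elementary/lE; rewrite mem_nth// sl.
exists (fun j => (nth (0, 0) l j).1), (fun j => (nth (0, 0) l j).2).
split; first split.
- by move=> j; have [p []] := El _ (ltn_ord j).
- by move=> j; have [p []] := El _ (ltn_ord j).
- by move=> j; have [p []] := El _ (ltn_ord j).
- move=> j j' jj'; have [p Ep] := El _ (ltn_ord j); have [p' Ep'] := El _ (ltn_ord j').
  by apply: (elementary_crossing_disjoint c0 Ep Ep'); rewrite nth_uniq ?sl.
- move=> j; have [p [_ _ _ [[-> ->]|[-> ->]] _]] := El _ (ltn_ord j).
    split; first by exists p.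
    by rewrite intrD (_ : _ - _ = c) ?gtr0_norm//; ring.
  split; first by exists (p + 1).
  by rewrite intrD (_ : _ - _ = - c) ?normrN ?gtr0_norm//; ring.
Qed.

End Crossings.

Section PackingToCrossings.
Context {R : realType}.
Implicit Types (s t c rho : R) (f g : R -> R).

(** The least point of the compact set of times in [[u, v]] with value [y]; a value above [y] before
    it would produce an earlier one by the intermediate value theorem. *)
Lemma first_hit f (u v y : R) : continuous f -> u < v -> f u < y -> y <= f v ->
  exists v', [/\ u < v', v' <= v, f v' = y & forall r, u <= r < v' -> f r < y].
Proof.
move=> cf uv fu fv.
have ivt x : u <= x -> y <= f x -> exists2 z, u <= z <= x & f z = y.
  move=> ux yx; have := @IVT R f u x y ux (continuous_subspaceT cf).
  rewrite ge_min le_max (ltW fu) yx orbT => /(_ isT)[z].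
  by rewrite in_itv/=; exists z.
pose Z := `[u, v] `&` f @^-1` [set y].
have cZ : compact Z.
  apply: compact_closedI; first exact: segment_compact.
  by apply: preimage_closed; [move=> x _; exact: cf|exact: closed_eq].
have Z0 : Z !=set0.
  by have [z uz fz] := ivt v (ltW uv) fv; exists z; split => //=; rewrite in_itv.
have ci : continuous (@id R) by move=> x; exact: cvg_id.
have [v' /set_mem[/= + fv'] min] := compact_EVT_min Z0 cZ (continuous_subspaceT ci).
rewrite in_itv/= => /andP[uv' v'v]; exists v'; split => //.
  rewrite lt_neqAle uv' andbT; apply: contraTneq fu => ->; first by rewrite fv' ltxx.
move=> r /andP[ur rv']; rewrite ltNge; apply/negP => yr.
have [z /andP[uz zr] fz] := ivt r ur yr.
have := min z; rewrite inE /Z/= in_itv/= uz/= (le_trans zr)/= ?(le_trans (ltW rv'))//.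
by move=> /(_ (conj isT fz)); rewrite leNgt (le_lt_trans zr rv').
Qed.

(** [v'] is the first time at [b], and [u'] the last time at [a] before it, obtained as a first hit
    of the path turned by [r -> - f (- r)]. *)
Lemma exit_enter f (u v a b : R) : continuous f -> u < v -> a < b -> f u = a -> f v = b ->
  exists u' v', [/\ u <= u', u' < v', v' <= v, f u' = a & f v' = b] /\
    forall r, u' < r < v' -> a < f r < b.
Proof.
move=> cf uv ab fu fv.
have [v' [uv' v'v fv' lt]] : exists v', [/\ u < v', v' <= v, f v' = b & forall r, u <= r < v' -> f r < b].
  by apply: first_hit => //; rewrite ?fu ?fv.
have cg : continuous (fun r => - f (- r)).
  by move=> r; apply: cvgN; apply: continuous_comp; [exact: opp_continuous|exact: cf].
have [x [lx xu fx gt]] : exists x, [/\ - v' < x, x <= - u, - f (- x) = - a &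
    forall r, - v' <= r < x -> - f (- r) < - a].
  by apply: first_hit => //; rewrite ?ltrN2 ?opprK ?fv' ?fu.
exists (- x), v'; split; first split => //.
- by rewrite lerNr.
- by rewrite ltrNl.
- by apply: oppr_inj.
- move=> r /andP[xr rv']; apply/andP; split; last first.
    by apply: lt; rewrite rv' andbT; lra.
  have := gt (- r); rewrite opprK ltrN2; apply.
  by rewrite lerN2 (ltW rv') ltrNl.
Qed.

Lemma elementary_crossing_exists s t c rho f (u v : R) (p : int) : 0 < c -> continuous f ->
  s <= u -> u < v -> v <= t -> f u = rho + p%:~R * c -> `|f v - f u| = c ->
  exists uv q, [/\ elementary_crossing s t c rho f uv q, u <= uv.1 & uv.2 <= v].
Proof.
move=> c0 cf su uv vt fu; have [up|down] := leP (f u) (f v).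
  rewrite ger0_norm ?subr_ge0// => fv.
  have [|u' [v' [[uu' u'v' v'v fu' fv'] h]]] := @exit_enter f u v (f u) (f v) cf uv _ erefl erefl.
    by rewrite -subr_gt0 fv.
  exists (u', v'), p; split => //; split => //=.
  - exact: le_trans su uu'.
  - exact: le_trans v'v vt.
  - by left; rewrite fu' fv' intrD -fu; split => //; lra.
  - by move=> r /h; rewrite fu (_ : f v = rho + (p + 1)%:~R * c)// intrD; lra.
rewrite ltr0_norm ?subr_lt0// => fv.
have cN : continuous (fun r => - f r) by move=> r; apply: cvgN; exact: cf.
have [|u' [v' [[uu' u'v' v'v fu' fv'] h]]] :=
    @exit_enter (fun r => - f r) u v (- f u) (- f v) cN uv _ erefl erefl.
  by rewrite ltrN2.
(* A downward move from level [p] crosses the strip above level [p - 1]. *)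
exists (u', v'), (p - 1); split => //; split => //=.
- exact: le_trans su uu'.
- exact: le_trans v'v vt.
- by right; rewrite subrK intrB; move: fu' fv' => /oppr_inj -> /oppr_inj ->; split => //; lra.
- by move=> r /h; rewrite subrK intrB; lra.
Qed.

(** Each interval of the packing contains a crossing, and crossings in disjoint intervals are
    distinct. *)
Lemma level_crossings_of_packing s t c rho f (n : nat) (u v : 'I_n -> R) :
  0 < c -> continuous f -> crossing_packing s t c rho f u v ->
  (n%:R%:E <= level_crossings s t c (fun u => (f u - rho)%R))%E.
Proof.
move=> c0 cf [[su uv vt disj] uvc].
have ex j : exists x : R * R, [/\ exists q, elementary_crossing s t c rho f x q,
    u j <= x.1 & x.2 <= v j].
  have [[p fu] fv] := uvc j.
  have [x [q [xq ux xv]]] := elementary_crossing_exists c0 cf (su j) (uv j) (vt j) fu fv.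
  by exists x; split => //; exists q.
have [x xP] := choice ex.
apply/level_crossings_geP => //; exists [seq x j | j <- enum 'I_n]; split.
- rewrite map_inj_in_uniq ?enum_uniq// => j j' _ _ xx'.
  apply/eqP; apply: contrapT => /negP jj'.
  have [[q [_ l _ _ _]] a1 a2] := xP j; have [[q' [_ l' _ _ _]] b1 b2] := xP j'.
  rewrite -xx' in b1 b2 l'.
  by have /orP[] := disj _ _ jj'; lra.
- by rewrite size_map size_enum_ord.
- by move=> _ /mapP[j _ ->]; apply/level_crossing_elementary; have [] := xP j.
Qed.

Lemma eq_level_crossings s t c f g : (forall r, s <= r <= t -> f r = g r) ->
  level_crossings s t c f = level_crossings s t c g.
Proof.
move=> fg; apply: eq_esum => p _; rewrite /strip_crossings /upcrossings /downcrossings.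
have fg1 u v : s <= u -> u < v -> v <= t -> f u = g u /\ f v = g v.
  by move=> *; split; apply: fg; apply/andP; split; lra.
have fg2 u v r : s <= u -> u < v -> v <= t -> u < r < v -> f r = g r.
  by move=> su uv vt /andP[ur rv]; apply: fg; apply/andP; split; lra.
congr (_ + _)%E; apply: (congr1 counting); apply/seteqP; split => -[u v] /= [[su uv vt h1 h2] h3];
  have [e1 e2] := fg1 _ _ su uv vt; rewrite ?e1 ?e2 in h1 h2 *; split => // r ur;
  by rewrite -?(fg2 _ _ _ su uv vt ur) ?h3// ?(fg2 _ _ _ su uv vt ur) ?h3.
Qed.

(** Counts are integers or infinite, so a supremum at least [x > n] yields a grid with more than
    [n], hence at least [n.+1], crossings. *)
Lemma sup_level_crossings_geP s t c f (x : R) (n : nat) : 0 < c -> continuous f ->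
  n%:R < x -> x <= n.+1%:R ->
  (x%:E <= sup_level_crossings s t c f)%E <->
  exists rho, exists u v : 'I_n.+1 -> R, crossing_packing s t c rho f u v.
Proof.
move=> c0 cf nx xn; split => [xsup|[rho [u [v uvP]]]]; last first.
  apply: (@le_trans _ _ (n.+1%:R%:E)); first by rewrite lee_fin.
  apply: (le_trans (level_crossings_of_packing c0 cf uvP)).
  by apply: ereal_sup_ubound; exists rho.
have [_ [rho _ <-] rhoK] : exists2 y, [set level_crossings s t c (fun u => (f u - rho)%R) | rho in [set: R]] y
    & (n%:R%:E < y)%E.
  by apply: ereal_sup_gt; rewrite (lt_le_trans _ xsup)// lte_fin.
exists rho; apply: packing_of_level_crossings => //.
move: rhoK; rewrite level_crossingsE// /counting.
do 2 case: asboolP => _; rewrite ?addey ?addye ?leey//.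
by rewrite -EFinD lte_fin lee_fin -natrD ltr_nat ler_nat.
Qed.

End PackingToCrossings.

(** * Measurability *)

Lemma nbhs_rV_rat {R : realType} (N : nat) (z : 'rV[R]_N) (U : set 'rV[R]_N) :
  nbhs z U -> exists q : 'rV[rat]_N, U (map_mx ratr q).
Proof.
move=> [B zB BU].
have ex i : exists q : rat, B ord0 i (ratr q).
  have /nbhs_ballP[e /= e0 eB] := zB ord0 i.
  have [|q qz] := @rat_in_itvoo R (z ord0 i - e) (z ord0 i + e); first by lra.
  exists q; apply: eB; rewrite /ball/= ltr_distlC.
  by move: qz; rewrite in_itv.
have [q qB] := choice ex.
by exists (\row_i q i); apply: BU => i j; rewrite ord1 !mxE.
Qed.

Section Clamp.
Context {R : realType}.
Variables s t : R.
Hypothesis st : s <= t.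

(** Projection of the line onto [[s, t]]: it extends a path on [[s, t]] to a continuous function on
    the line without changing its crossings there. *)
Definition clamp (r : R) : R := if r <= s then s else if r <= t then r else t.

Lemma clamp_itv r : s <= clamp r <= t.
Proof.
by rewrite /clamp; case: (leP r s) => // h; [rewrite lexx|case: (leP r t) => h'; rewrite ?lexx ?st// ltW].
Qed.

Lemma clamp_id r : s <= r <= t -> clamp r = r.
Proof. by rewrite /clamp => /andP[sr ->]; case: leP => // rs; apply/eqP; rewrite eq_le sr. Qed.

Lemma clamp_lipschitz x y : `|clamp x - clamp y| <= `|x - y|.
Proof.
have st0 := st; have h1 := ler_norm (x - y); have h2 := ler_norm (y - x); rewrite distrC in h2.
rewrite /clamp ler_norml; move: `|x - y| h1 h2 => e h1 h2.
by case: (leP x s) => ?; case: (leP x t) => ?; case: (leP y s) => ?; case: (leP y t) => ?;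
  apply/andP; split; lra.
Qed.

Lemma clamp_continuous : continuous clamp.
Proof.
move=> x; apply/cvgrPdist_lt => e e0.
apply: filterS (nbhsx_ballx x e e0) => y; rewrite /ball/= => xy.
exact: le_lt_trans (clamp_lipschitz _ _) xy.
Qed.

Lemma within_continuous_clamp (f : R -> R) (A : set R) : (forall r, s <= r <= t -> A r) ->
  {within A, continuous f} -> continuous (f \o clamp).
Proof.
move=> stA /subspace_continuousP cf x.
apply: (cvg_comp clamp f _ (cf (clamp x) (stA _ (clamp_itv x)))) => B wB.
apply: (@filterS _ (nbhs x) _ _ _ _ (clamp_continuous wB)) => y /=.
by apply; apply: stA; exact: clamp_itv.
Qed.

End Clamp.

Section PackingGap.
Context {R : realType}.
Variables (s t c : R) (n : nat).
Hypotheses (st : s <= t) (c_gt0 : 0 < c).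
Local Notation N := n.+1.
Implicit Types (F : R -> R) (p : {ffun 'I_N -> int}) (e : {ffun 'I_N -> bool}).

(** Twice the positive part: a continuous way to express [x <= 0] as an equation. *)
Definition excess (x : R) : R := `|x| + x.

Lemma excess_ge0 x : 0 <= excess x.
Proof. by rewrite /excess; have := lerNnormlW (lexx `|x|); lra. Qed.

Lemma excess_eq0 x : (excess x == 0) = (x <= 0).
Proof.
rewrite /excess; apply/eqP/idP => [|x0]; last by rewrite ler0_norm//; lra.
by have := normr_ge0 x; lra.
Qed.

Let term_ge0 (x y z : R) : 0 <= `|x| + `|y| + excess z.
Proof. by apply: addr_ge0; [exact: addr_ge0|exact: excess_ge0]. Qed.

Let left_end (z : 'rV[R]_(N + N)) (j : 'I_N) := clamp s t (z ord0 (lshift N j)).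
Let right_end (z : 'rV[R]_(N + N)) (j : 'I_N) := clamp s t (z ord0 (rshift N j)).

(** A nonnegative function of the endpoints whose zeros are the packings with relative levels [p]
    and signs [e]. The shift of the grid is eliminated by measuring levels from the first left end,
    and a product of excesses encodes the disjunction in disjointness. *)
Definition packing_gap F p e (z : 'rV[R]_(N + N)) : R :=
  \sum_(j < N) (`|F (left_end z j) - F (left_end z ord0) - (p j)%:~R * c| +
                `|F (right_end z j) - F (left_end z j) - (-1) ^+ e j * c| +
                excess (left_end z j - right_end z j)) +
  \sum_(j < N) \sum_(j' < N | j != j')
     excess (right_end z j - left_end z j') * excess (right_end z j' - left_end z j).

Lemma packing_gap_ge0 F p e z : 0 <= packing_gap F p e z.
Proof.
rewrite addr_ge0// sumr_ge0// => j _.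
by apply: sumr_ge0 => j' _; rewrite mulr_ge0 ?excess_ge0.
Qed.

Lemma packing_gap_eq0 F : (exists rho (u v : 'I_N -> R), crossing_packing s t c rho F u v) <->
  exists p e z, packing_gap F p e z = 0.
Proof.
split=> [[rho [u [v [[su uv vt disj] cr]]]]|[p [e [z /eqP]]]]; last first.
  rewrite paddr_eq0; last 2 first.
  - by apply: sumr_ge0 => j _; exact: term_ge0.
  - by apply: sumr_ge0 => j _; apply: sumr_ge0 => j' _; rewrite mulr_ge0 ?excess_ge0.
  rewrite psumr_eq0; last by move=> j _; exact: term_ge0.
  rewrite psumr_eq0; last first.
    by move=> j _; apply: sumr_ge0 => j' _; rewrite mulr_ge0 ?excess_ge0.
  move=> /andP[/allP h1 /allP h2].
  have {}h1 j : [/\ F (left_end z j) = F (left_end z ord0) + (p j)%:~R * c,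
     F (right_end z j) - F (left_end z j) = (-1) ^+ e j * c & left_end z j <= right_end z j].
    have := h1 j (mem_index_enum _); rewrite paddr_eq0; [|exact: addr_ge0|exact: excess_ge0].
    rewrite paddr_eq0 ?normr_ge0// !normr_eq0 excess_eq0 subr_le0.
    by move=> /andP[/andP[/eqP a1 /eqP a2] a3]; split => //; lra.
  have abs j : `|F (right_end z j) - F (left_end z j)| = c.
    by have [_ -> _] := h1 j; rewrite normrM normrX normrN1 expr1n mul1r gtr0_norm.
  exists (F (left_end z ord0)), (left_end z), (right_end z); split; first split.
  - by move=> j; have /andP[] := clamp_itv st (z ord0 (lshift N j)).
  (* The gap only gives a weak inequality; equal endpoints are excluded because the path moves by
     [c > 0]. *)
  - move=> j; rewrite lt_neqAle; have [_ _ ->] := h1 j; rewrite andbT.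
    apply: contraTneq c_gt0 => lr; rewrite -(abs j) lr subrr normr0.
    by rewrite ltxx.
  - by move=> j; have /andP[] := clamp_itv st (z ord0 (rshift N j)).
  - move=> j j' jj'; have := h2 j (mem_index_enum _); rewrite psumr_eq0; last first.
      by move=> k _; rewrite mulr_ge0 ?excess_ge0.
    move=> /allP /(_ j' (mem_index_enum _)); rewrite jj' implyTb mulf_eq0.
    by rewrite !excess_eq0 !subr_le0.
  - by move=> j; split; [have [h _ _] := h1 j; exists (p j)|exact: abs].
have [q qP] := choice (fun j => (cr j).1).
exists [ffun j => q j - q ord0], [ffun j => F (v j) < F (u j)].
exists (row_mx (\row_j u j) (\row_j v j)).
have le j : left_end (row_mx (\row_j u j) (\row_j v j)) j = u j.
  by rewrite /left_end row_mxEl mxE clamp_id ?su ?(le_trans (ltW (uv _)))// vt.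
have re j : right_end (row_mx (\row_j u j) (\row_j v j)) j = v j.
  by rewrite /right_end row_mxEr mxE clamp_id ?vt ?(le_trans _ (ltW (uv _))).
rewrite /packing_gap !big1 ?addr0// => j _.
- apply: big1 => j' jj'; rewrite !le !re; apply/eqP; rewrite mulf_eq0 !excess_eq0 !subr_le0.
  exact: disj.
- rewrite !le !re !ffunE; apply/eqP; rewrite paddr_eq0; [|exact: addr_ge0|exact: excess_ge0].
  rewrite paddr_eq0 ?normr_ge0//.
  rewrite !normr_eq0 excess_eq0 subr_le0 (ltW (uv j)) andbT.
  have [_ fv] := cr j; rewrite !qP intrB; apply/andP; split; first by apply/eqP; ring.
  move: fv; rewrite -!qP; have [vu|uv'] := ltP (F (v j)) (F (u j)).
    by rewrite ltr0_norm ?subr_lt0// => <-; apply/eqP; ring.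
  by rewrite ger0_norm ?subr_ge0// => <-; apply/eqP; ring.
Qed.

Lemma packing_gap_continuous F p e : continuous (F \o clamp s t) ->
  continuous (packing_gap F p e).
Proof.
move=> cF z.
have cz i : (fun y : 'rV[R]_(N + N) => y ord0 i) y @[y --> z] --> z ord0 i.
  exact: coord_continuous.
have ccl i : (fun y : 'rV[R]_(N + N) => clamp s t (y ord0 i)) @ z --> clamp s t (z ord0 i).
  exact: (cvg_comp _ _ (cz i) (clamp_continuous st (x := _))).
have cFc i : (fun y : 'rV[R]_(N + N) => F (clamp s t (y ord0 i))) @ z -->
    F (clamp s t (z ord0 i)).
  exact: (cvg_comp _ _ (cz i) (cF _)).
have cex (f : 'rV[R]_(N + N) -> R) a : f y @[y --> z] --> a -> excess (f y) @[y --> z] --> excess a.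
  by move=> fa; exact: (cvgD (cvg_norm fa) fa).
pose f1 (j : 'I_N) (y : 'rV[R]_(N + N)) : R := `|F (left_end y j) - F (left_end y ord0) - (p j)%:~R * c| +
                `|F (right_end y j) - F (left_end y j) - (-1) ^+ e j * c| +
                excess (left_end y j - right_end y j).
pose f2 (j j' : 'I_N) (y : 'rV[R]_(N + N)) : R := excess (right_end y j - left_end y j') * excess (right_end y j' - left_end y j).
have t1 j : f1 j @ z --> f1 j z.
  apply: (cvgD (cvgD (cvg_norm (cvgB (cvgB (cFc _) (cFc _)) (cvg_cst _)))
    (cvg_norm (cvgB (cvgB (cFc _) (cFc _)) (cvg_cst _)))) (cex _ _ (cvgB (ccl _) (ccl _)))).
have t2 j j' : f2 j j' @ z --> f2 j j' z.
  exact: (cvgM (cex _ _ (cvgB (ccl _) (ccl _))) (cex _ _ (cvgB (ccl _) (ccl _)))).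
have fz : Filter (nbhs z) by exact: nbhs_filter.
have cs (P : pred 'I_N) f a := @cvg_sumr R 'rV[R]_(N + N) 'I_N (nbhs z) fz (index_enum 'I_N) P f a.
have s2 j := cs (fun j' => j != j') (f2 j) (fun j' => f2 j j' z) (t2 j).
exact: (cvgD (cs xpredT f1 (fun j => f1 j z) t1) (cs xpredT _ _ s2)).
Qed.

(* Compactness of the box and density of the rational points. *)
Lemma packing_gap_approx F p e : continuous (F \o clamp s t) ->
  (exists z, packing_gap F p e z = 0) <->
  forall k : nat, exists q : 'rV[rat]_(N + N),
    packing_gap F p e (map_mx ratr q) < k.+1%:R^-1.
Proof.
move=> cF; have cG := @packing_gap_continuous F p e cF; split=> [[z z0] k|approx].
  apply: (@nbhs_rV_rat _ _ z [set y | packing_gap F p e y < k.+1%:R^-1]).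
  by apply: (cvgr_lt _ (cG z)); rewrite z0 invr_gt0 ltr0n.
pose K := [set z : 'rV[R]_(N + N) | forall i, `[s, t]%classic (z ord0 i)].
have cK : compact K := @rV_compact R (N + N) (fun=> `[s, t]%classic) (fun=> @segment_compact R s t).
have K0 : K !=set0.
  by exists (const_mx s) => i /=; rewrite mxE in_itv/= lexx.
have [z zK zmin] := compact_EVT_min K0 cK (continuous_subspaceT cG).
exists z; apply/eqP; rewrite eq_le packing_gap_ge0 andbT.
apply/ler_addgt0Pr => eps eps0; rewrite add0r.
have [q qlt] := approx (Num.truncn eps^-1).
pose zq : 'rV[R]_(N + N) := \row_i clamp s t (ratr (q ord0 i)).
have zqK : zq \in K.
  by apply/mem_set => i /=; rewrite mxE in_itv/=; exact: clamp_itv.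
apply: (le_trans (zmin _ zqK)).
(* The gap reads its argument through [clamp], so a rational point may be moved into the box. *)
have -> : packing_gap F p e zq = packing_gap F p e (map_mx ratr q).
  have cc x : clamp s t (clamp s t x) = clamp s t x by rewrite clamp_id ?clamp_itv.
  have el j : left_end zq j = left_end (map_mx ratr q) j by rewrite /left_end !mxE cc.
  have er j : right_end zq j = right_end (map_mx ratr q) j by rewrite /right_end !mxE cc.
  rewrite /packing_gap; congr (_ + _); apply: eq_bigr => j _; first by rewrite !el !er.
  by apply: eq_bigr => j' _; rewrite !el !er.
apply: ltW; apply: (lt_le_trans qlt); rewrite invf_ple ?posrE ?ltr0n//.
by apply: ltW; exact: truncnS_gt.
Qed.

Context {d : measure_display} {T : measurableType d}.
Variable W : R -> T -> R.
Hypothesis mW : forall r, s <= r <= t -> measurable_fun [set: T] (W r).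

(** Only countable operations on values of the process at fixed times occur, whence measurability;
    on continuous paths [packing_eventP] identifies it with the existence of a packing. *)
Definition packing_event : set T :=
  \bigcup_(p : {ffun 'I_N -> int}) \bigcup_(e : {ffun 'I_N -> bool})
  \bigcap_(k : nat) \bigcup_(q : 'rV[rat]_(N + N))
    [set w | packing_gap (fun r => W r w) p e (map_mx ratr q) < k.+1%:R^-1].

Lemma packing_event_measurable : measurable packing_event.
Proof.
apply: countable_bigcupT_measurable => [|p]; first exact: countableP.
apply: countable_bigcupT_measurable => [|e]; first exact: countableP.
apply: bigcapT_measurable => k.
apply: countable_bigcupT_measurable => [|q]; first exact: countableP.
have mWc x : measurable_fun [set: T] (W (clamp s t x)).
  by apply: mW; exact: clamp_itv.
have mn a b (k' : R) : measurable_fun [set: T]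
    (fun x => `|W (clamp s t a) x - W (clamp s t b) x - k'|).
  apply: (@measurableT_comp _ _ _ _ _ _ (@Num.norm R R)).
    exact: normr_measurable.
  by apply: measurable_funB; [exact: measurable_funB|exact: measurable_cst].
suff mG : measurable_fun [set: T] (fun w => packing_gap (fun r => W r w) p e (map_mx ratr q)).
  have := mG measurableT `]-oo, k.+1%:R^-1[%classic (measurable_itv _).
  by rewrite setTI; congr measurable; apply/seteqP; split => w /=; rewrite in_itv.
apply: measurable_funD.
  apply: measurable_sum => j; apply: measurable_funD; last exact: measurable_cst.
  by apply: measurable_funD; exact: mn.
(* The overlap terms depend on the times only, not on the path. *)
apply: measurable_sum => j.
exact: measurable_cst.
Qed.

Lemma packing_eventP w : continuous ((fun r => W r w) \o clamp s t) ->
  packing_event w <->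
  exists rho (u v : 'I_N -> R), crossing_packing s t c rho (fun r => W r w) u v.
Proof.
move=> cW; rewrite packing_gap_eq0; split.
  move=> [p _ [e _ h]]; exists p, e; apply/packing_gap_approx => // k.
  by have [q _ ?] := h k I; exists q.
move=> [p [e /packing_gap_approx h]]; exists p => //; exists e => // k _.
by have [q ?] := h cW k; exists q.
Qed.

End PackingGap.

(** * Blocks *)

Section Blocks.
Context {R : realType}.

Lemma powRr_half_sqr (H c : R) : 0 < H -> 0 < c -> (c `^ H^-1) `^ (2 * H) = c ^+ 2.
Proof.
move=> H0 c0; rewrite -powRrM (_ : H^-1 * (2 * H) = 2%:R) ?powR_mulrn ?ltW//.
by field; rewrite gt_eqF.
Qed.

Lemma nat_ceil (x : R) : 0 < x -> exists n : nat, n%:R < x <= n.+1%:R.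
Proof.
move=> x0; have /andP[mx xm] := truncn_itv (ltW x0).
have [xe|xne] := eqVneq (Num.truncn x)%:R x.
  case: (Num.truncn x) xe mx xm => [xe|n xe _ _]; first by rewrite -xe ltxx in x0.
  by exists n; rewrite -xe lexx andbT ltr_nat.
by exists (Num.truncn x); rewrite lt_neqAle xne mx ltW.
Qed.

(** For [n >= r] the power [p] of [n] is at least the mean of [n] and of the power [p] of [r]: the
    first half gives a geometric series, the second the stated decay. *)
Lemma expR_tail_sum (a p : R) : 0 < a -> 1 <= p -> forall r m : nat, (0 < r)%N ->
  \sum_(r <= n < m) expR (- (a * n%:R `^ p)) <=
  (1 - expR (- (a / 2)))^-1 * expR (- (a / 2 * r%:R `^ p)).
Proof.
move=> a0 p1 r m r0; set z := expR (- (a / 2)).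
have z1 : z < 1 by rewrite -expR0 ltr_expR oppr_lt0 divr_gt0.
have z0 : 0 < z by rewrite expR_gt0.
apply: (@le_trans _ _ (\sum_(r <= n < m) (expR (- (a / 2 * r%:R `^ p)) * z ^+ n))).
  rewrite big_nat [leRHS]big_nat; apply: ler_sum => n /andP[rn _].
  rewrite /z -expRM_natr -expRD ler_expR.
  have n1 : 1 <= n%:R :> R by rewrite ler1n (leq_trans r0).
  have h1 : n%:R <= n%:R `^ p :> R by apply: le1r_powR.
  have h2 : r%:R `^ p <= n%:R `^ p :> R.
    by apply: powR_homo_le; rewrite ?ler_nat// (le_trans ler01).
  have : a / 2 * (n%:R + r%:R `^ p) <= a / 2 * (2 * n%:R `^ p).
    by rewrite ler_wpM2l ?divr_ge0 ?(ltW a0)//; lra.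
  by lra.
rewrite -mulr_sumr mulrC ler_wpM2r ?expR_ge0//.
rewrite -[leRHS]mul1r ler_pdivlMr ?subr_gt0// mulr_suml.
have -> : \sum_(r <= n < m) z ^+ n * (1 - z) = \sum_(r <= n < m) (- z ^+ n.+1 - - z ^+ n).
  by apply: eq_bigr => n _; rewrite exprS; ring.
have [rm|mr] := leqP r m; last by rewrite big_geq ?ler01// ltnW.
rewrite telescope_sumr// opprK addrC ltW//.
have := exprn_gt0 m z0; have := exprn_ile1 r (ltW z0) (ltW z1); lra.
Qed.

Variables (s t c rho L : R) (f : R -> R) (m N : nat) (u v : 'I_m -> R).
Hypotheses (L_gt0 : 0 < L) (tN : t <= s + N%:R * L).
Hypothesis uvP : crossing_packing s t c rho f u v.

Definition block_intervals (b : nat) : {set 'I_m} :=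
  [set j | (s + b%:R * L <= u j) && (v j <= s + b.+1%:R * L)]%SET.

(* Every interval outside all blocks straddles a block boundary, and each
   boundary is straddled at most once. *)
Lemma block_intervals_sum : (m <= \sum_(b < N) #|block_intervals b|.+1)%N.
Proof.
have [[su uv vt disj] _] := uvP.
pose idx j := Num.truncn ((u j - s) / L).
have idxP j : s + (idx j)%:R * L <= u j < s + (idx j).+1%:R * L.
  have := truncn_itv (_ : 0 <= (u j - s) / L).
  rewrite divr_ge0 ?subr_ge0 ?(ltW L_gt0)// => /(_ isT).
  by rewrite ler_pdivlMr// ltr_pdivrMr// -/(idx j) => /andP[h1 h2]; apply/andP; split; lra.
have idxN j : (idx j < N)%N.
  rewrite -(ltr_nat R) -(ltr_pM2r L_gt0).
  by have /andP[h1 h2] := idxP j; have h3 := uv j; have h4 := vt j; have h5 := tN; lra.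
have mE : m = (\sum_(b < N) #|[set j | idx j == b]%SET|)%N.
  under eq_bigr do rewrite -sum1_card.
  under eq_bigr => b _ do (under eq_bigl => j do rewrite inE).
  rewrite (exchange_big_dep xpredT)//= -[LHS]card_ord -sum1_card.
  apply: eq_bigr => j _; rewrite (big_pred1 (Ordinal (idxN j)))// => b.
apply: (@leq_trans (\sum_(b < N) #|[set j | idx j == b]%SET|)); first by rewrite -mE.
apply: leq_sum => b _.
pose bad := [set j | (idx j == b) && (s + b.+1%:R * L < v j)]%SET.
have bad1 : (#|bad| <= 1)%N.
  apply/card_le1_eqP => j j'; rewrite !inE => /andP[/eqP ij vj] /andP[/eqP ij' vj'] /=.
  apply/eqP; apply: contrapT => /negP jj'.
  have /andP[_ h1] := idxP j; have /andP[_ h2] := idxP j'.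
  rewrite ij in h1; rewrite ij' in h2.
  by have /orP[] := disj _ _ jj'; lra.
rewrite -addn1; apply: (@leq_trans (#|block_intervals b| + #|bad|)); last by rewrite leq_add2l.
apply: leq_trans (leq_card_setU _ _).
apply: subset_leq_card; apply/fintype.subsetP => j; rewrite !inE => /eqP ij.
have /andP[h1 _] := idxP j; rewrite ij in h1; rewrite h1 ij eqxx/=.
by have [//|h] := leP (v j) _.
Qed.

End Blocks.

Section BlockPacking.
Context {d : measure_display} {T : measurableType d} {R : realType}.
Variables (H : R) (W : R -> T -> R) (w : T).
Hypotheses (H_gt0 : 0 < H).

(** With signs making every increment equal to [c], the signed sum is [n * c]; off the block event
    chaining would bound it by half of that. *)
Lemma block_event_of_packing (s t c rho L : R) (m : nat) (u v : 'I_m -> R) (b n : nat) :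
  0 <= s -> 0 < c -> 0 < L ->
  {within `[0, +oo[, continuous (fun r => W r w)} ->
  crossing_packing s t c rho (fun r => W r w) u v ->
  (0 < n)%N -> (n <= #|block_intervals s L u v b|)%N ->
  block_event H W (s + b%:R * L) L c n w.
Proof.
move=> s0 c0 L0 cW [[su uv vt disj] uvc] n0 nb.
apply: contrapT => /not_block_event nE.
pose g (j : 'I_n) : 'I_m := enum_val (widen_ord nb j).
have g_inj : injective g by move=> j j' /enum_val_inj /(congr1 val) /= jj'; apply: val_inj.
have gb j : (s + b%:R * L <= u (g j)) && (v (g j) <= s + b.+1%:R * L).
  by have := enum_valP (widen_ord nb j); rewrite inE.
pose sgn j := W (v (g j)) w < W (u (g j)) w.
have sb0 : 0 <= s + b%:R * L by rewrite addr_ge0// mulr_ge0// ltW.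
have h : \sum_(j < n) (-1) ^+ sgn j * (W (v (g j)) w - W (u (g j)) w) <= c * (n%:R / 2).
  apply: (@chaining_le _ _ _ W w n (s + b%:R * L) L sgn (u \o g) (v \o g)
    n0 L0 _ _ _ _ (fun i => c * level_threshold H n i)) => //=.
  - by move=> j; have /andP[] := gb j.
  - by move=> j; rewrite ltW.
  - by move=> j; have /andP[_] := gb j; rewrite -natr1 mulrDl mul1r addrA.
  - by move=> j j' jj'; apply: disj; rewrite (inj_eq g_inj).
  - by move=> k; rewrite -mulr_sumr ler_wpM2l ?(ltW c0)// level_threshold_sum.
have : \sum_(j < n) (-1) ^+ sgn j * (W (v (g j)) w - W (u (g j)) w) = n%:R * c.
  rewrite (eq_bigr (fun=> c)); first by rewrite sumr_const card_ord mulr_natl.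
  move=> j _; have [_ <-] := uvc (g j); rewrite /sgn.
  have [lt|ge] := ltP (W (v (g j)) w) (W (u (g j)) w).
    by rewrite ltr0_norm ?subr_lt0// expr1 mulN1r.
  by rewrite ger0_norm ?subr_ge0// expr0 mul1r.
move=> sE; move: h; rewrite sE => h.
have : 0 < c * n%:R by rewrite mulr_gt0// ltr0n.
by lra.
Qed.

(** A block containing [k >= r] intervals realizes the events for all sizes from [r] to [k], so
    [k + 1] is at most [r] plus the number of its events. Summing over blocks gives [m <= N * r]
    plus the total, and [m >= N * (r + 1)]. *)
Lemma block_event_count (s t c rho L : R) (m N r : nat) (u v : 'I_m -> R) :
  0 <= s -> 0 < c -> 0 < L -> t <= s + N%:R * L ->
  {within `[0, +oo[, continuous (fun r => W r w)} ->
  crossing_packing s t c rho (fun r => W r w) u v ->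
  (0 < r)%N -> (N * r.+1 <= m)%N ->
  (N <= \sum_(b < N) \sum_(r <= n < m.+1)
     (w \in block_event H W (s + b%:R * L) L c n))%N.
Proof.
move=> s0 c0 L0 tN cW uvP r0 Nm.
have sumI := block_intervals_sum L0 tN uvP.
have count b : (#|block_intervals s L u v b|.+1 <=
    \sum_(r <= n < m.+1) (w \in block_event H W (s + b%:R * L) L c n) + r)%N.
  set k := #|_|; have km : (k <= m)%N by rewrite -[leqRHS]card_ord max_card.
  have [kr|rk] := ltnP k r; first by lia.
  rewrite (big_cat_nat (leqW rk) (_ : k.+1 <= m.+1)%N)//=.
  apply: (@leq_trans (\sum_(r <= n < k.+1) 1 + r)).
    by rewrite sum_nat_const_nat muln1 subnK// leqW.
  rewrite leq_add2r (leq_trans _ (leq_addr _ _))//.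
  rewrite big_nat [leqRHS]big_nat; apply: leq_sum => n /andP[rn nk].
  rewrite mem_set//; apply: (block_event_of_packing s0 c0 L0 cW uvP) => //.
  exact: leq_trans r0 rn.
have : (m <= \sum_(b < N) (\sum_(r <= n < m.+1)
    (w \in block_event H W (s + b%:R * L) L c n) + r))%N.
  by apply: (leq_trans sumI); apply: leq_sum => b _; exact: count.
rewrite big_split/= sum_nat_const card_ord; lia.
Qed.

End BlockPacking.

Lemma markov_count {d : measure_display} {T : measurableType d} {R : realType}
    (P : probability T R) (I : finType) (A : I -> set T) (M : set T) (K : nat) :
  (forall i, measurable (A i)) -> measurable M ->
  (forall w, M w -> (K <= \sum_i (w \in A i))%N) ->
  (K%:R%:E * P M <= \sum_i P (A i))%E.
Proof.
move=> mA mM MK; rewrite -integral_cst//.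
pose S w : R := \sum_i \1_(A i) w.
have SE : (\int[P]_w (S w)%:E = \sum_i P (A i))%E.
  under eq_integral do rewrite /S -sumEFin.
  rewrite ge0_integral_sum//.
    by apply: eq_bigr => i _; rewrite integral_indic// setIT.
  by move=> i; apply/measurable_EFinP; exact: measurable_indic.
have S0 w : 0 <= S w by apply: sumr_ge0.
have mS : measurable_fun [set: T] (EFin \o S).
  by apply/measurable_EFinP; apply: measurable_sum => i; exact: measurable_indic.
rewrite -SE; apply: (@le_trans _ _ (\int[P]_(w in M) (S w)%:E)%E).
  apply: ge0_le_integral => //.
  - by move=> w _; rewrite lee_fin.
  - exact: measurable_funTS.
  - by move=> w /MK; rewrite -(ler_nat R) natr_sum -lee_fin.
by apply: ge0_subset_integral => // w _; rewrite lee_fin.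
Qed.

Lemma eq_crossing_packing {R : realType} (s t c rho : R) (f g : R -> R) (n : nat)
    (u v : 'I_n -> R) : (forall r, s <= r <= t -> f r = g r) ->
  crossing_packing s t c rho f u v -> crossing_packing s t c rho g u v.
Proof.
move=> fg [[su uv vt disj] cr]; split=> // j.
have [[p fu] fv] := cr j; rewrite -!fg; first by split => //; exists p.
  by rewrite vt andbT (le_trans (su j))// ltW.
by rewrite su (le_trans (ltW (uv j))).
Qed.

Lemma level_exceedanceP {R : realType} (s t c x : R) (n : nat) (f : R -> R) :
  0 <= s -> s <= t -> 0 < c -> n%:R < x <= n.+1%:R ->
  {within `[0, +oo[, continuous f} ->
  (x%:E <= sup_level_crossings s t c f)%E <->
  exists rho (u v : 'I_n.+1 -> R), crossing_packing s t c rho f u v.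
Proof.
move=> s0 st c0 /andP[nx xn] cf.
have cF : continuous (f \o clamp s t).
  apply: (within_continuous_clamp st _ cf) => r /andP[sr _] /=.
  by rewrite in_itv/= andbT (le_trans s0).
have fF r : s <= r <= t -> f r = (f \o clamp s t) r by move=> /clamp_id /= ->.
have -> : sup_level_crossings s t c f = sup_level_crossings s t c (f \o clamp s t).
  congr ereal_sup; apply: eq_imagel => rho _.
  by apply: eq_level_crossings => r /fF ->.
rewrite (sup_level_crossings_geP s t c0 cF nx xn).
split=> -[rho [u [v uvP]]]; exists rho, u, v; apply: eq_crossing_packing uvP => // r rst.
  by rewrite -fF.
Qed.

(** * Tail of the crossing count *)

Section Tail.
Context {d : measure_display} {T : measurableType d} {R : realType}.
Variables (P : probability T R) (H : R) (W : R -> T -> R).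
Hypotheses (H_gt0 : 0 < H) (H_lt1 : H < 1).
Hypothesis fW : fractional_brownian_motion P H W.

Lemma fbm_continuity_null : exists Z : set T, [/\ measurable Z, P Z = 0%E &
  forall w, ~ Z w -> {within `[0, +oo[, continuous (fun t => W t w)}].
Proof.
have [_ _ [Z [mZ Z0 ZP]] _] := fW; exists Z; split => // w Zw.
by apply: contrapT => nc; apply: Zw; apply: ZP.
Qed.

(** On the event at least [N] pairs of block and size occur, while their expected number is at most
    [N * b]; Markov's inequality cancels [N]. *)
Lemma packing_event_probability_le (s t c L b : R) (n N r : nat) :
  0 <= s -> s <= t -> 0 < c -> 0 < L -> t <= s + N%:R * L ->
  (0 < r)%N -> (0 < N)%N -> (N * r.+1 <= n.+1)%N ->
  (forall j k, (r <= k)%N -> measurable (block_event H W (s + j%:R * L) L c k)) ->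
  (forall j, (\sum_(r <= k < n.+2) P (block_event H W (s + j%:R * L) L c k) <= b%:E)%E) ->
  (P (packing_event s t c n W) <= b%:E)%E.
Proof.
move=> s0 st c0 L0 tN r0 N0 Nn mB Bb.
have [Z [mZ PZ cZ]] := fbm_continuity_null.
have mE : measurable (packing_event s t c n W).
  apply: packing_event_measurable => // x /andP[sx _].
  by apply: (fbm_measurable fW); exact: le_trans sx.
set E := packing_event _ _ _ _ _ in mE *.
have mEZ : measurable (E `\` Z) by exact: measurableD.
(* The count of block events requires a continuous path, hence the removal of a null set. *)
have -> : P E = P (E `\` Z).
  apply/eqP; rewrite eq_le; apply/andP; split; last by rewrite le_measure ?inE//; exact: subDsetl.
  apply: (@le_trans _ _ (P ((E `\` Z) `|` Z))).
    rewrite le_measure ?inE//; first exact: measurableU.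
    by move=> w Ew; have [Zw|Zw] := pselect (Z w); [right|left].
  have := measureU2 P mEZ mZ; rewrite -[X in (_ <= X)%E]/(P (E `\` Z) + P Z)%E PZ adde0; exact.
pose A (i : 'I_N * 'I_n.+2) : set T :=
  if (r <= i.2)%N then block_event H W (s + i.1%:R * L) L c i.2 else set0.
have mA i : measurable (A i) by rewrite /A; case: ifP => // ri; exact: mB.
have bigA (V : Type) (x0 : V) (op : Monoid.com_law x0) (F : set T -> V) : F set0 = x0 ->
    \big[op/x0]_i F (A i) = \big[op/x0]_(j < N) \big[op/x0]_(r <= k < n.+2)
      F (block_event H W (s + j%:R * L) L c k).
  move=> F0; rewrite -(pair_bigA _ (fun j k => F (A (j, k))))/=.
  apply: eq_bigr => j _; rewrite big_geq_mkord [RHS]big_mkcond/=.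
  by apply: eq_bigr => k _; rewrite /A/=; case: ifP.
have /(markov_count P mA mEZ) : forall w, (E `\` Z) w -> (N <= \sum_i (w \in A i))%N.
  move=> w [Ew Zw]; have cw := cZ _ Zw.
  have cF : continuous ((fun r => W r w) \o clamp s t).
    apply: (within_continuous_clamp st _ cw) => x /andP[sx _] /=.
    by rewrite in_itv/= andbT (le_trans s0).
  have [rho [u [v uvP]]] := (packing_eventP n st c0 cF).1 Ew.
  rewrite (bigA nat _ _ (fun B => nat_of_bool (w \in B))).
    exact: (block_event_count H_gt0 s0 c0 L0 tN cw uvP r0 Nn).
  by rewrite in_set0.
rewrite (bigA (\bar R) _ _ (fun B => P B)) ?measure0// => /le_trans h.
have N0R : (0 < N%:R :> R) by rewrite ltr0n.
rewrite -(@lee_pmul2l _ N%:R%:E)// ?lte_fin//.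
apply: h; apply: (@le_trans _ _ (\sum_(j < N) b%:E)%E); first exact: lee_sum.
by rewrite sumEFin sumr_const card_ord -EFinM mulr_natl.
Qed.

End Tail.

Theorem mainTheorem8 (R : realType) (H : R) (H_gt0 : 0 < H) (H_lt1 : H < 1) :
  exists A B C : R, [/\ 0 < A, 0 < B & 0 < C] /\
    forall (d : measure_display) (T : measurableType d) (P : probability T R)
      (W : R -> T -> R), fractional_brownian_motion P H W ->
    forall s t c v : R, 0 <= s -> s < t -> 0 < c -> c <= (t - s) `^ H / 2 ->
      1 <= v ->
      probability_le P
        [set w | ((C * (t - s) * c `^ (- H^-1) * v)%:E <=
                  sup_level_crossings s t c (fun u => W u w))%E]
        (A * expR (- (B * v `^ (1 + Num.min (2 * H) 1))))%:E.
Proof.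
have [a [n0 [a0 n00 blockP]]] := block_event_probability H_gt0 H_lt1.
set p := 1 + hurst_exponent H in blockP; rewrite -/(hurst_exponent H) -/p.
have p1 : 1 <= p by rewrite /p lerDl ltW// hurst_exponent_gt0.
have z1 : 0 < 1 - expR (- (a / 2)).
  by rewrite subr_gt0 -expR0 ltr_expR oppr_lt0 divr_gt0.
(* The first constant is the factor 3 of one block times the geometric sum, the second the exponent
   kept by [expR_tail_sum]. The third ensures [N * (r + 1) <= n + 1] below, from [N <= 2 * Tn] and
   [r + 1 <= (n0 + 3) * v]. *)
exists (3 * (1 - expR (- (a / 2)))^-1), (a / 2), (2 * (n0%:R + 3)); split.
  by split; [exact: divr_gt0|exact: divr_gt0|apply: mulr_gt0 => //; exact: ltr_wpDl].
move=> d T P W fW s t c v s0 st c0 cts v1.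
pose L := c `^ H^-1; have L0 : 0 < L by rewrite powR_gt0.
have Lc : L `^ (2 * H) = c ^+ 2 by exact: powRr_half_sqr.
have ts0 : 0 < t - s by rewrite subr_gt0.
have Lts : L <= t - s.
  have -> : t - s = ((t - s) `^ H) `^ H^-1.
    by rewrite -powRrM mulfV ?gt_eqF// powRr1// ltW.
  apply: powR_homo_le; rewrite ?invr_ge0 ?(ltW H_gt0) ?(ltW c0)//.
  apply: (le_trans cts); rewrite ler_pdivrMr// ler_peMr ?powR_ge0//.
  by rewrite ler1n.
pose Tn := (t - s) / L.
have T1 : 1 <= Tn by rewrite ler_pdivlMr// mul1r.
have -> : 2 * (n0%:R + 3) * (t - s) * c `^ (- H^-1) * v = 2 * (n0%:R + 3) * Tn * v.
  by rewrite powRN -/L /Tn mulrA.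
set x := _ * v; have T0 : 0 < Tn by rewrite (lt_le_trans ltr01).
have v0 : 0 < v := lt_le_trans ltr01 v1.
have n3 : 0 < n0%:R + 3 :> R by exact: ltr_wpDl.
have x0 : 0 < x by exact: mulr_gt0 (mulr_gt0 (mulr_gt0 (ltr0n _ 2) n3) T0) v0.
(* Reaching [x] crossings amounts to having a packing of size [n.+1]. *)
have [n nx] := nat_ceil x0.
(* [N] blocks of length [L] cover [[s, t]]; [r] is at least [v], for the decay, and at least [n0],
   for the one-block bound. *)
pose N := (Num.truncn Tn).+1; pose r := ((Num.truncn v).+1 + n0)%N.
have /andP[Tn1 Tn2] := truncn_itv (ltW T0).
have /andP[v1' v2'] := truncn_itv (le_trans ler01 v1).
have tN : t <= s + N%:R * L.
  by move: Tn2; rewrite /Tn ltr_pdivrMr// -/N; lra.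
have vr : v <= r%:R.
  by rewrite /r natrD; apply: (le_trans (ltW v2')); rewrite lerDl.
have r0 : (0 < r)%N by [].
have Nr : (N * r.+1 <= n.+1)%N.
  rewrite -(ler_nat R); have /andP[_ +] := nx; apply: le_trans.
  rewrite natrM.
  have h1 : N%:R <= 2 * Tn by rewrite /N -natr1; lra.
  have h2 : r.+1%:R <= (n0%:R + 3) * v.
    have : n0%:R <= n0%:R * v by rewrite ler_peMr.
    by rewrite /r -addSn natrD -[(Num.truncn v).+2%:R]natr1 -[(Num.truncn v).+1%:R]natr1; lra.
  have -> : x = (2 * Tn) * ((n0%:R + 3) * v) by rewrite /x; ring.
  by rewrite ler_pM.
have sj j : 0 <= s + j%:R * L by rewrite addr_ge0// mulr_ge0// ltW.
have bP j k (rk : (r <= k)%N) := blockP d T P W fW (s + j%:R * L) L c k (sj j) L0 c0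
  (leq_trans (leq_addl _ _) rk) Lc.
have PE : (P (packing_event s t c n W) <=
    (3 * (1 - expR (- (a / 2)))^-1 * expR (- (a / 2 * v `^ p)))%:E)%E.
  apply: (packing_event_probability_le H_gt0 fW s0 (ltW st) c0 L0 tN r0 _ Nr) => //.
    by move=> j k rk; exact: (bP j k rk).1.
  move=> j; apply: (@le_trans _ _ (\sum_(r <= k < n.+2) (3 * expR (- (a * k%:R `^ p)))%:E)%E).
    rewrite big_nat [leRHS]big_nat; apply: lee_sum => k /andP[rk _].
    exact: (bP j k rk).2.
  rewrite sumEFin lee_fin -mulr_sumr -mulrA ler_wpM2l//.
  apply: (le_trans (expR_tail_sum a0 p1 n.+2 r0)).
  rewrite ler_wpM2l ?invr_ge0 ?(ltW z1)// ler_expR lerN2 ler_wpM2l ?divr_ge0 ?(ltW a0)//.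
  by apply: powR_homo_le => //; rewrite (le_trans ler01).
have [Z [mZ PZ cZ]] := fbm_continuity_null fW.
exists (packing_event s t c n W); split => //.
  apply: packing_event_measurable; first exact: ltW.
  by move=> y /andP[sy _]; apply: (fbm_measurable fW); exact: le_trans sy.
(* Off [Z] the path is continuous and both events say that a packing of size [n.+1] exists, so their
   symmetric difference lies in [Z]. *)
exists Z; split => // w; apply: contraPP => Zw.
have cw := cZ _ Zw.
have cF : continuous ((fun r => W r w) \o clamp s t).
  apply: (within_continuous_clamp (ltW st) _ cw) => y /andP[sy _] /=.
  by rewrite in_itv/= andbT (le_trans s0).
have e1 := packing_eventP n (ltW st) c0 cF.
have e2 := level_exceedanceP s0 (ltW st) c0 nx cw.
by move=> [[/e1/e2 h1 h2]|[/e2/e1 h1 h2]].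
Qed.
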